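(* There are complex box mappings $F_i \colon \mathcal U_i \to \mathcal V_i$, $i \in \{1,2,3\}$, with the following properties: (1) $K(F_1) = \mathcal V_1$ and $J_{\mathcal U}(F_1) = \emptyset$. (2) The filled Julia set $K(F_2)$ has full Lebesgue measure in $\mathcal U_2$ and empty interior, and there exists a positive (indeed full) measure set of points in $K(F_2)$ whose orbits do not accumulate on any critical point. Moreover, both $J_K(F_2)$ and $K(F_2)$ carry invariant line fields. (3) $\mathcal V_3$ is a disk, and each connected component $U$ of $\mathcal U_3$ is compactly contained in $\mathcal V_3$ and contains a wandering disk for $F_3$. Moreover, these examples can be constructed so that $\mathcal U_i$, $\mathcal V_i$ and $F_i$ are symmetric with respect to the real line.
   Context: A topological disk is an open simply connected subset of $\mathbb C$; a Jordan disk is a topological disk whose boundary is a Jordan curve. A complex box mapping is a holomorphic map $F\colon\mathcal U\to\mathcal V$ between open sets $\mathcal U\subset\mathcal V\subset\mathbb C$ such that: (i) $F$ has finitely many critical points; (ii) $\mathcal V$ is a union of finitely many Jordan disks with disjoint closures; (iii) every component $V$ of $\mathcal V$ is either a component of $\mathcal U$, or $V\cap\mathcal U$ is a (possibly infinite) union of Jordan disks with pairwise disjoint closures, each compactly contained in $V$; (iv) for every component $U$ of $\mathcal U$, $F(U)$ is a component of $\mathcal V$ and $F\colon U\to F(U)$ is proper. The filled Julia set is $K(F)=\bigcap_{n\ge 0}F^{-n}(\mathcal V)$ (the points whose whole forward orbit stays in the domain of $F$). Two candidate Julia sets are $J_{\mathcal U}(F)=\partial K(F)\cap\mathcal U$ and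 $J_K(F)=\partial K(F)\cap K(F)$. A line field on a set $B$ is an assignment of a real line through each point $z$ of a subset $E\subset B$ of positive Lebesgue measure such that the slope is a measurable function of $z$; it is invariant under $F$ if $F^{-1}(E)=E$ and the differential $D_zF$ maps the line at $z$ to the line at $F(z)$. An open set $B$ in the domain of $F$ is wandering if $F^k(B)\neq F^\ell(B)$ for all $k\ne\ell$ and $B$ is not in the basin of a periodic attractor; a wandering disk is a topological disk that is wandering. Symmetry of $F_i$ with respect to the real line means $\mathcal U_i,\mathcal V_i$ are invariant under complex conjugation and $F_i(\bar z)=\overline{F_i(z)}$. *)

(* Defs.v *)
From mathcomp Require Import all_boot all_order all_algebra.
From mathcomp Require Import all_classical all_reals all_analysis.
From mathcomp Require Import measurable_realfun complex.

Set Implicit Arguments.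
Unset Strict Implicit.
Unset Printing Implicit Defensive.

Import Order.TTheory GRing.Theory Num.Theory.
Import numFieldNormedType.Exports.

Local Open Scope classical_set_scope.
Local Open Scope complex_scope.
Local Open Scope ring_scope.

(* The complex plane, as the one-dimensional normed space over R[i]: the
   topology is that of the modulus, and derivatives are complex derivatives. *)
Notation plane R := (R[i]^o).

Section PlaneTopology.
Context {R : realType}.
Implicit Types A B D U K : set (plane R).

Definition bd A : set (plane R) := closure A `\` interior A.

Definition component A D : Prop :=
  exists2 x, A x & D = connected_component A x.

Definition compactly_contained A B : Prop :=
  compact (closure A) /\ closure A `<=` B.

Definition path_connected A : Prop :=
  forall x y, A x -> A y ->
    exists g : R -> plane R,
      [/\ {within `[0, 1], continuous g},
          g @` `[0, 1] `<=` A, g 0 = x & g 1 = y].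

(* [H s] is, for [s] from 0 to 1, a homotopy with fixed endpoints, inside [A],
   from the loop [g] to the constant loop at its base point. *)
Definition null_homotopic A (g : R -> plane R) : Prop :=
  exists H : R * R -> plane R,
    [/\ {within `[0, 1] `*` `[0, 1], continuous H},
        H @` (`[0, 1] `*` `[0, 1]) `<=` A,
        {in `[0, 1], forall t, H (0, t) = g t},
        {in `[0, 1], forall t, H (1, t) = g 0} &
        {in `[0, 1], forall s, H (s, 0) = g 0 /\ H (s, 1) = g 0}].

Definition simply_connected A : Prop :=
  [/\ A !=set0, path_connected A &
      forall g : R -> plane R, {within `[0, 1], continuous g} ->
        g @` `[0, 1] `<=` A -> g 0 = g 1 -> null_homotopic A g].

Definition topological_disk A : Prop := open A /\ simply_connected A.

Definition jordan_curve A : Prop :=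
  exists g : R -> plane R,
    [/\ {within `[0, 1], continuous g}, g 0 = g 1,
        {in `[0, 1[ &, injective g} & A = g @` `[0, 1]].

Definition jordan_disk A : Prop := topological_disk A /\ jordan_curve (bd A).

Definition conj_invariant A : Prop := [set conjc z | z in A] = A.

End PlaneTopology.

Section PlaneMeasure.
Context {R : realType}.

(* The Borel structure and the Lebesgue measure of the plane are those of
   [R * R], read through [plane_of]. *)
Definition plane_of (p : measurableTypeR R * measurableTypeR R) : plane R :=
  p.1 +i* p.2.

Definition planar_measurable (A : set (plane R)) : Prop :=
  measurable (plane_of @^-1` A).

Definition area (A : set (plane R)) : \bar R :=
  (lebesgue_measure \x lebesgue_measure)%E (plane_of @^-1` A).

Definition planar_null (A : set (plane R)) : Prop :=
  (lebesgue_measure \x lebesgue_measure)%E.-negligible (plane_of @^-1` A).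

End PlaneMeasure.

(* A map F : U -> V is given by a total function F together with U and V; only
   the values of F on U are ever used. *)
Section BoxMappings.
Context {R : realType}.
Variables (U V : set (plane R)) (F : plane R -> plane R).

Definition preimage_in (A : set (plane R)) : set (plane R) :=
  U `&` F @^-1` A.

Definition critical : set (plane R) := [set z | U z /\ 'D_1 F z = 0].

Definition proper_onto_image (D : set (plane R)) : Prop :=
  forall K, compact K -> K `<=` F @` D -> compact (D `&` F @^-1` K).

Definition disjoint_jordan_disks (D : set (set (plane R))) : Prop :=
  (forall A, D A -> jordan_disk A) /\ trivIset D closure.

Record complex_box_mapping : Prop := ComplexBoxMapping {
  cbm_dom_open : open U;
  cbm_cod_open : open V;
  cbm_dom_neq0 : U !=set0;
  cbm_dom_cod : U `<=` V;
  cbm_maps : F @` U `<=` V;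
  cbm_holomorphic : forall z, U z -> derivable F z 1;
  cbm_critical : finite_set critical;
  cbm_cod_disks : exists D : set (set (plane R)),
    [/\ finite_set D, disjoint_jordan_disks D & V = \bigcup_(A in D) A];
  cbm_dom_disks : forall W, component V W ->
    component U W \/
    exists D : set (set (plane R)),
      [/\ disjoint_jordan_disks D,
          forall A, D A -> compactly_contained A W &
          W `&` U = \bigcup_(A in D) A];
  cbm_proper : forall W, component U W ->
    component V (F @` W) /\ proper_onto_image W
}.

(* [iter n preimage_in V] is the set F^{-n}(V) for the partial map F. *)
Definition filled_julia : set (plane R) :=
  \bigcap_n iter n preimage_in V.

Definition julia_dom : set (plane R) := bd filled_julia `&` U.
Definition julia_filled : set (plane R) := bd filled_julia `&` filled_julia.

Definition orbit_clusters_at (z c : plane R) : Prop :=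
  cluster ((fun n => iter n F z) @ \oo) c.

(* Line through the origin with slope s, the value +oo being the vertical
   slope. *)
Definition line_of_slope (s : \bar R) : set (plane R) :=
  if s is r%:E then [set w : plane R | complex.Im w = r * complex.Re w]
  else [set w : plane R | complex.Re w = 0].

(* The line at z in E is the one through z with slope [s z]; the value -oo is
   excluded so that every line has a single slope.  The differential of F at z
   is the multiplication by F'(z) on directions. *)
Definition carries_invariant_line_field (B : set (plane R)) : Prop :=
  exists (E : set (plane R)) (s : plane R -> \bar R),
    [/\ E `<=` B, planar_measurable E & (0 < area E)%E] /\
    [/\ measurable_fun (plane_of @^-1` E) (s \o plane_of),
        forall z, E z -> s z != -oo%E,
        preimage_in E = E &
        forall z, E z ->
          [set 'D_1 F z * w | w in line_of_slope (s z)] =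
          line_of_slope (s (F z))].

Definition periodic_point (p : plane R) : Prop :=
  filled_julia p /\ exists2 n, (0 < n)%N & iter n F p = p.

Definition orbit_set (p : plane R) : set (plane R) :=
  [set iter n F p | n in [set: nat]].

Definition orbit_basin (p : plane R) : set (plane R) :=
  [set z | filled_julia z /\
           forall N : set (plane R), open N -> orbit_set p `<=` N ->
             \forall n \near \oo, N (iter n F z)].

(* A periodic orbit is an attractor when its basin has interior points; this
   includes hyperbolic attracting and parabolic cycles. *)
Definition periodic_attractor (p : plane R) : Prop :=
  periodic_point p /\ interior (orbit_basin p) !=set0.

(* [B `<=` filled_julia] says that all the iterates F^k are defined on B. *)
Definition wandering (B : set (plane R)) : Prop :=
  [/\ open B, B `<=` filled_julia,
      forall k l : nat, k <> l -> iter k F @` B <> iter l F @` B &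
      ~ exists2 p, periodic_attractor p & B `<=` orbit_basin p].

Definition wandering_disk (B : set (plane R)) : Prop :=
  topological_disk B /\ wandering B.

Definition real_symmetric : Prop :=
  [/\ conj_invariant U, conj_invariant V &
      forall z, U z -> F (conjc z) = conjc (F z)].

End BoxMappings.

(* Main.v *)
(** (1) is the identity map of a square.

    (2) Let V be the square (-1, 1)^2 and let the components of U be the
    complementary squares of the Sierpinski carpet, each of them mapped onto V
    by a similarity without rotation.  The carpet is covered by eight copies of
    itself at scale 1/3 and by finitely many segments, so its area m satisfies
    m <= (8/9) m and vanishes; pulling back, almost every point of V has its
    whole orbit in U.  The derivative is real and positive, hence horizontal
    lines are preserved; there are no critical points.  Since inverse branches
    contract by 1/3 and V is not contained in U, the filled Julia set has empty
    interior.

    (3) Let V be the round disk on the diameter [0, 1].  Near 0 it looks like a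
    half plane, so it contains disjoint round disks U_n, with real diameters and
    accumulating at 0, of hyperbolic radius growing so fast that real Möbius
    maps U_n -> V can send a smaller round disk B_n of U_n into B_{n+1} although
    the ratio of the end points of the real diameter of B_n stays below 2.  The
    orbit of B_n never meets the same component twice, so it is attracted by no
    periodic orbit. *)
Require Import Defs.
From mathcomp Require Import all_boot all_order all_algebra.
From mathcomp Require Import all_classical all_reals all_analysis.
From mathcomp Require Import measurable_realfun complex.
From mathcomp Require Import ring lra zify.


Set Implicit Arguments.
Unset Strict Implicit.
Unset Printing Implicit Defensive.

Import Order.TTheory GRing.Theory Num.Theory.
Import numFieldNormedType.Exports.

Local Open Scope classical_set_scope.
Local Open Scope ring_scope.

Local Notation Re := complex.Re.
Local Notation Im := complex.Im.

(** * Coordinates and limits in the plane *)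

Section PlaneCoordinates.
Context {R : realType}.
Implicit Types (z w c : plane R) (A B C D U V W : set (plane R)).

Lemma plane_ext z w : Re z = Re w -> Im z = Im w -> z = w.
Proof. by case: z w => [x y] [x' y'] /= -> ->. Qed.

Lemma normC_def z : `|z| = (Num.sqrt (Re z ^+ 2 + Im z ^+ 2))%:C%C.
Proof. exact: normc_def. Qed.

Lemma norm_lt_coords z (e : R) : `|Re z| < e / 2 -> `|Im z| < e / 2 ->
  `|z| < e%:C%C.
Proof.
move=> h1 h2.
have h1' := normr_ge0 (Re z).
have e0 : 0 < e by lra.
rewrite normC_def ltcR -[ltRHS]ger0_norm ?ltW // -sqrtr_sqr ltr_sqrt ?exprn_gt0 //.
rewrite -[Re z ^+ 2]real_normK ?num_real // -[Im z ^+ 2]real_normK ?num_real //.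
by have h2' := normr_ge0 (Im z); nra.
Qed.

Lemma coords_lt_norm z (e : R) : `|z| < e%:C%C -> `|Re z| < e /\ `|Im z| < e.
Proof.
rewrite normC_def ltcR => h.
split; apply: le_lt_trans h; rewrite -sqrtr_sqr ler_sqrt ?addr_ge0 ?sqr_ge0 //.
  by rewrite lerDl sqr_ge0.
by rewrite lerDr sqr_ge0.
Qed.

Lemma gt0_realE (e : R[i]) : 0 < e -> 0 < Re e /\ e = (Re e)%:C%C.
Proof. by case: e => a b; rewrite ltcE /= => /andP[/eqP -> ?]. Qed.

Lemma cvg_plane (T : Type) (F : set_system T) {FF : Filter F} (u v : T -> R)
    (a b : R) :
  u @ F --> a -> v @ F --> b ->
  (fun t => (u t +i* v t)%C : plane R) @ F --> ((a +i* b)%C : plane R).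
Proof.
move=> /cvgrPdist_lt ua /cvgrPdist_lt vb; apply/cvgrPdist_lt => e /gt0_realE[e0 ->].
have e2 : 0 < Re e / 2 by rewrite divr_gt0.
near=> t; apply: norm_lt_coords => /=.
  by near: t; exact: ua.
by near: t; exact: vb.
Unshelve. all: by end_near. Qed.

#[global] Instance plane_nbhs_filter (z : plane R) :
  Filter (nbhs z) := nbhs_filter z.

Lemma continuous_Re : continuous (@complex.Re R : plane R -> R).
Proof.
move=> z; apply/(@cvgrPdist_lt _ _ _ _ (nbhs_filter z)) => e e0.
have e0' : 0 < e%:C%C by rewrite ltcR.
apply: (@filterS _ _ (nbhs_filter z) _ _ _ (nbhsx_ballx z _ e0')) => w.
by rewrite -ball_normE /= => /coords_lt_norm[]; case: (z) w => ? ? [].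
Qed.

Lemma continuous_Im : continuous (@complex.Im R : plane R -> R).
Proof.
move=> z; apply/(@cvgrPdist_lt _ _ _ _ (nbhs_filter z)) => e e0.
have e0' : 0 < e%:C%C by rewrite ltcR.
apply: (@filterS _ _ (nbhs_filter z) _ _ _ (nbhsx_ballx z _ e0')) => w.
by rewrite -ball_normE /= => /coords_lt_norm[]; case: (z) w => ? ? [].
Qed.

Lemma continuous_plane (T : topologicalType) (u v : T -> R) :
  continuous u -> continuous v ->
  continuous (fun t => (u t +i* v t)%C : plane R).
Proof. by move=> cu cv t; apply: cvg_plane; [exact: cu|exact: cv]. Qed.

Lemma scale_Re (a : R) z : Re (a%:C%C * z) = a * Re z.
Proof. by case: z => x y /=; rewrite mul0r subr0. Qed.

Lemma scale_Im (a : R) z : Im (a%:C%C * z) = a * Im z.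
Proof. by case: z => x y /=; rewrite mul0r addr0. Qed.

Lemma add_Re z w : Re (z + w) = Re z + Re w.
Proof. by case: z w => ? ? []. Qed.

Lemma add_Im z w : Im (z + w) = Im z + Im w.
Proof. by case: z w => ? ? []. Qed.

Lemma sub_Re z w : Re (z - w) = Re z - Re w.
Proof. by case: z w => ? ? []. Qed.

Lemma sub_Im z w : Im (z - w) = Im z - Im w.
Proof. by case: z w => ? ? []. Qed.

(* [cvgD], [cvgM], ... with the target type fixed: unifying the generic
   statements with [plane R] when they are applied backwards diverges. *)
Lemma plane_cvgD (T : Type) (F : set_system T) {FF : Filter F}
    (f g : T -> plane R) (a b : plane R) :
  f @ F --> a -> g @ F --> b -> (fun t => f t + g t) @ F --> a + b.
Proof. by move=> fa gb; exact: (cvgD fa gb). Qed.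

Lemma plane_cvgB (T : Type) (F : set_system T) {FF : Filter F}
    (f g : T -> plane R) (a b : plane R) :
  f @ F --> a -> g @ F --> b -> (fun t => f t - g t) @ F --> a - b.
Proof. by move=> fa gb; exact: (cvgB fa gb). Qed.

Lemma plane_cvgM (T : Type) (F : set_system T) {FF : Filter F}
    (f g : T -> plane R) (a b : plane R) :
  f @ F --> a -> g @ F --> b ->
  (fun t => f t * g t : plane R) @ F --> (a * b : plane R).
Proof. by move=> fa gb; exact: (cvgM fa gb). Qed.

Lemma plane_cvgV (T : Type) (F : set_system T) {FF : Filter F}
    (f : T -> plane R) (a : plane R) :
  a != 0 -> f @ F --> a -> (fun t => (f t)^-1 : plane R) @ F --> (a^-1 : plane R).
Proof. by move=> a0 fa; exact: (cvgV a0 fa). Qed.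

Lemma plane_cvg_cst (T : Type) (F : set_system T) {FF : Filter F} (a : plane R) :
  (fun=> a) @ F --> a.
Proof. exact: cvg_cst. Qed.

Lemma plane_cvg_neq0 (T : Type) (F : set_system T) {FF : Filter F}
    (f : T -> plane R) (a : plane R) :
  f @ F --> a -> a != 0 -> \forall t \near F, f t != 0.
Proof. exact: cvgr_neq0. Qed.

Lemma plane_cvg_id z : (fun w : plane R => w) @ nbhs z --> z.
Proof. exact: cvg_id. Qed.

End PlaneCoordinates.

Arguments plane_cvg_cst {R T} F {FF} a.
Arguments plane_cvg_id {R} z.

(** * Convex sets, closures and compactness *)

Section ConvexDomains.
Context {R : realType}.
Implicit Types (z w c : plane R) (A B C D U V W : set (plane R)).

Definition mix (s : R) z w : plane R := (1 - s)%:C%C * z + s%:C%C * w.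

Definition convex_in A := forall z w (s : R), A z -> A w -> 0 <= s <= 1 -> A (mix s z w).

Lemma cvg_mix (T : Type) (F : set_system T) {FF : Filter F} (s : T -> R)
    (u v : T -> plane R) (a : R) (z w : plane R) :
  s @ F --> a -> u @ F --> z -> v @ F --> w ->
  (fun t => mix (s t) (u t) (v t)) @ F --> mix a z w.
Proof.
move=> sa uz vw; rewrite /mix.
have cR (b : T -> R) (x : R) : b @ F --> x ->
    ((b t)%:C%C : plane R) @[t --> F] --> (x%:C%C : plane R).
  by move=> bx; apply: cvg_plane => //; exact: cvg_cst.
have s1 : (fun t => 1 - s t) @ F --> 1 - a by apply: cvgB; [exact: cvg_cst|].

exact: (plane_cvgD (plane_cvgM (cR _ _ s1) uz) (plane_cvgM (cR _ _ sa) vw)).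
Qed.

Lemma mix0 z w : mix 0 z w = z.
Proof. by rewrite /mix subr0 mul1r mul0r addr0. Qed.

Lemma mix1 z w : mix 1 z w = w.
Proof. by rewrite /mix subrr mul1r mul0r add0r. Qed.

Lemma mixxx (s : R) z : mix s z z = z.
Proof. by rewrite /mix -mulrDl -rmorphD subrK mul1r. Qed.

(** The image of a path from a base point [x] is a connected subset of [A], so the connected subsets
    of [A] through [x] cover [A]. *)
Lemma path_connected_connected A : path_connected A -> connected A.
Proof.
move=> pA; have [->|/set0P[x Ax]] := eqVneq A set0; first exact: connected0.
pose P (B : set (plane R)) := [/\ B x, B `<=` A & connected B].
have -> : A = \bigcup_(B in P) B.
  apply/seteqP; split=> [y Ay|y [B [_ BA _]] /BA//].
  have [g [gc gA g0 g1]] := pA _ _ Ax Ay.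
  exists (g @` `[0, 1]).
    split=> //; first by exists 0; rewrite //= in_itv /= lexx ler01.
    by apply: connected_continuous_connected => //; exact: segment_connected.
  by exists 1; rewrite //= in_itv /= lexx ler01.
apply: bigcup_connected; last by move=> B [].
by exists x => B [].
Qed.

(** Segments serve as paths, and a loop contracts along the segments to its base point. The
    endpoints stay fixed during the homotopy because [mix s x x] is [x]. *)
Lemma convex_topological_disk A : open A -> A !=set0 -> convex_in A ->
  topological_disk A.
Proof.
move=> oA A0 cA; split=> //; split=> //.
- move=> x y Ax Ay; exists (fun t => mix t x y); split.
  + apply: continuous_subspaceT => t.
    by apply: cvg_mix; [exact: cvg_id|exact: cvg_cst|exact: cvg_cst].
  + by move=> y0 [t /=]; rewrite in_itv /= => t01 <-; exact: cA.
  + exact: mix0.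
  + exact: mix1.
- move=> g gc gA g01.
  exists (fun p => mix p.1 (g p.2) (g 0)); split.
  + apply/subspace_continuousP => -[s t] /= [s01 t01].
    apply: cvg_mix; [by apply: cvg_within_filter; exact: cvg_fst| |exact: plane_cvg_cst].
    (* Continuity of [g] is only relative to [0, 1]; the second projection sends relative
       neighbourhoods in the square to relative neighbourhoods in [0, 1]. *)
    apply: (@cvg_comp _ _ _ snd g _ (within `[0, 1] (nbhs t))).
      move=> P nP.
      exists (setT, [set b : R | `[0, 1]%classic b -> P b]); first by split; [exact: filterT|].
      by move=> [a b] /= [_ Pb] [_]; exact: Pb.
    exact: ((subspace_continuousP _ g).1 gc t t01).
  + move=> y0 [[s t] /= [s01 t01]] <-; apply: cA; first by apply: gA; exists t.
      by apply: gA; exists 0; rewrite //= in_itv /= lexx ler01.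
    by move: s01; rewrite in_itv.
  + by move=> t _; rewrite /= mix0.
  + by move=> t _; rewrite /= mix1.
  + by move=> s _; rewrite /= -g01 !mixxx.
Qed.

(** A point [z] of [C] is the limit, as s decreases to 0, of the points [mix s z c], which belong to
    [A]. *)
Lemma closure_starlike A C c : A `<=` C -> closed C ->
  (forall z (s : R), C z -> 0 < s <= 1 -> A (mix s z c)) -> closure A = C.
Proof.
move=> AC cC sA; apply/seteqP; split.
  by rewrite ((closure_id _).1 cC); exact: closure_subset.
move=> z Cz B Bz.
have : mix s z c @[s --> 0^'+] --> z.
  rewrite -[X in _ --> X](mix0 z c).
  apply: cvg_mix; [|exact: cvg_cst|exact: cvg_cst].
  exact/cvg_at_right_filter/cvg_id.
move=> /(_ _ Bz) Bs.
have [s [/= [s0 s1] Bs']] : exists s : R, (0 < s /\ s <= 1) /\ B (mix s z c).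
  near (0 : R)^'+ => s; exists s; split; last by near: s.
  by split; near: s; [exact: nbhs_right_gt|exact: nbhs_right_le].
by exists (mix s z c); split=> //; apply: sA => //; rewrite s0.
Unshelve. all: by end_near. Qed.

Lemma closed_bounded_compact A (a : R) : closed A ->
  (forall z, A z -> `|Re z| <= a /\ `|Im z| <= a) -> compact A.
Proof.
move=> cA bA.
pose f (p : R * R) : plane R := (p.1 +i* p.2)%C.
have fc : continuous f.
  by apply: continuous_plane => p; [exact: cvg_fst|exact: cvg_snd].
apply: (@subclosed_compact _ _ (f @` (`[- a, a] `*` `[- a, a]))) => //.
  apply: continuous_compact; first exact: continuous_subspaceT.
  by apply: compact_setX; exact: segment_compact.
move=> z /bA[]; rewrite !ler_norml => h1 h2; exists (Re z, Im z).
  by split; rewrite /= in_itv.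
exact: plane_ext.
Qed.

End ConvexDomains.

(** * Balls of a norm as Jordan disks *)

Section GaugeBalls.
Context {R : realType}.
Implicit Types (z w c : plane R) (A B C D U V W : set (plane R)) (q : plane R -> R).

(** A common interface for the maximum norm and the modulus, so that squares and round disks are
    treated together. The bounds on the coordinates make closed balls compact; every ball has an
    affine image of the unit sphere as boundary, whence the last field. *)
Record gauge q : Prop := Gauge {
  gauge_continuous : continuous q;
  gauge_scale : forall (a : R) z, 0 <= a -> q (a%:C%C * z) = a * q z;
  gauge_add : forall z w, q (z + w) <= q z + q w;
  gauge_Re : forall z, `|Re z| <= q z;
  gauge_Im : forall z, `|Im z| <= q z;
  gauge_sphere : jordan_curve [set z | q z = 1]
}.

Definition gball q c (r : R) : set (plane R) := [set z | q (z - c) < r].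
Definition cgball q c (r : R) : set (plane R) := [set z | q (z - c) <= r].

Variable q : plane R -> R.
Hypothesis gq : gauge q.

Let continuous_qB c : continuous (fun z : plane R => q (z - c)).
Proof.
move=> z.
apply: (@continuous_comp _ _ _ (fun w : plane R => w - c) q z).
  by apply: plane_cvgB; [exact: plane_cvg_id|exact: plane_cvg_cst].
exact: (gauge_continuous gq).
Qed.

Lemma gauge_ge0 z : 0 <= q z.
Proof. exact: le_trans (normr_ge0 _) (gauge_Re gq z). Qed.

Lemma gauge0 : q 0 = 0.
Proof. by rewrite -(mulr0 0%:C%C) (gauge_scale gq) ?mul0r. Qed.

Lemma open_gball c r : open (gball q c r).
Proof.
have -> : gball q c r = (fun z : plane R => q (z - c)) @^-1` [set x | x < r] by [].
by apply: open_comp; [move=> ? _; exact: continuous_qB|exact: open_lt].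
Qed.

Lemma closed_cgball c r : closed (cgball q c r).
Proof.
have -> : cgball q c r = (fun z : plane R => q (z - c)) @^-1` [set x | x <= r] by [].
by apply: closed_comp; [move=> ? _; exact: continuous_qB|exact: closed_le].
Qed.

Lemma gball_sub c r : gball q c r `<=` cgball q c r.
Proof. by move=> z; rewrite /gball /cgball /=; exact: ltW. Qed.

Lemma gball_center c r : 0 < r -> gball q c r c.
Proof. by rewrite /gball /= subrr gauge0. Qed.

Lemma gauge_mix c z w (s : R) : 0 <= s <= 1 ->
  q (mix s z w - c) <= (1 - s) * q (z - c) + s * q (w - c).
Proof.
move=> /andP[s0 s1].
have -> : mix s z w - c = (1 - s)%:C%C * (z - c) + s%:C%C * (w - c).
  by rewrite /mix rmorphB rmorph1; ring.
by apply: le_trans (gauge_add gq _ _) _; rewrite !(gauge_scale gq) ?subr_ge0.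
Qed.

Lemma gball_convex c r : convex_in (gball q c r).
Proof.
move=> z w s; rewrite /gball /= => zr wr s01.
apply: le_lt_trans (gauge_mix c z w s01) _.
(* For s = 0 only [z] counts; for s > 0 the term of [w] is strictly below s r. *)
move: s01 => /andP[]; rewrite le_eqVlt => /predU1P[<- _|s0 s1].
  by rewrite subr0 mul1r mul0r addr0.
have := ltW zr; nra.
Qed.

Lemma closure_gball c r : 0 < r -> closure (gball q c r) = cgball q c r.
Proof.
move=> r0; apply: (@closure_starlike _ _ _ c).
- exact: gball_sub.
- exact: closed_cgball.
- move=> z s; rewrite /gball /cgball /= => zr /andP[s0 s1].
  have s01 : 0 <= s <= 1 by rewrite ltW.
  apply: le_lt_trans (gauge_mix c z c s01) _; rewrite subrr gauge0.
  have := gauge_ge0 (z - c); nra.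
Qed.

Lemma compact_cgball c r : compact (cgball q c r).
Proof.
apply: (@closed_bounded_compact _ _ (`|Re c| + `|Im c| + r)).
  exact: closed_cgball.
move=> z; rewrite /cgball /= => zr.
have h1 := gauge_Re gq (z - c); have h2 := gauge_Im gq (z - c).
have sub_le (a b : R) : `|a| <= `|b| + `|a - b|.
  by rewrite -{1}(subrK b a) addrC ler_normD.
have e1 : `|Re z| <= `|Re c| + `|Re (z - c)| by rewrite sub_Re.
have e2 : `|Im z| <= `|Im c| + `|Im (z - c)| by rewrite sub_Im.
have := normr_ge0 (Re c); have := normr_ge0 (Im c).
split; lra.
Qed.

Lemma jordan_curve_affine A c (r : R) : 0 < r -> jordan_curve A ->
  jordan_curve [set z | A (r^-1%:C%C * (z - c))].
Proof.
move=> r0 [g [gc g01 gi ->]].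
have rC0 : r%:C%C != 0 :> R[i] by rewrite eq_complex /= eqxx andbT gt_eqF.
exists (fun t => c + r%:C%C * g t); split.
- apply/subspace_continuousP => t At.
  apply: plane_cvgD; first exact: plane_cvg_cst.
  apply: plane_cvgM; first exact: plane_cvg_cst.
  exact: ((subspace_continuousP _ g).1 gc t At).
- by rewrite g01.
- by move=> s t s01 t01 /addrI /(mulfI rC0); exact: gi.
- rewrite fmorphV; apply/seteqP; split=> [z [t t01 gtz]|_ [t t01 <-]].
    by exists t => //; rewrite gtz mulrA divff // mul1r addrC subrK.
  by exists t => //; rewrite addrAC subrr add0r mulrA mulVf // mul1r.
Qed.

Lemma bd_gball c r : 0 < r -> bd (gball q c r) = [set z | q (z - c) = r].
Proof.
move=> r0; rewrite /bd closure_gball // ((interior_id _).1 (@open_gball c r)).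
apply/seteqP; split=> z; rewrite /gball /cgball /=.
  by move=> [zr /negP]; rewrite -leNgt => rz; apply/eqP; rewrite eq_le zr rz.
by move=> ->; rewrite ltxx lexx.
Qed.

Lemma jordan_disk_gball c r : 0 < r -> jordan_disk (gball q c r).
Proof.
move=> r0; split.
  apply: convex_topological_disk.
  - exact: open_gball.
  - by exists c; exact: gball_center.
  - exact: gball_convex.
rewrite bd_gball //.
have -> : [set z | q (z - c) = r] = [set z | q (r^-1%:C%C * (z - c)) = 1].
  apply/seteqP; split=> z /=; rewrite (gauge_scale gq) ?invr_ge0 ?(ltW r0) //.
    by move=> ->; rewrite mulVf ?gt_eqF.
  by move/(congr1 ( *%R r)); rewrite mulrA divff ?gt_eqF // mul1r mulr1.
exact: (jordan_curve_affine c r0 (gauge_sphere gq)).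
Qed.

End GaugeBalls.

(** * The maximum norm and squares *)

Section MaxGauge.
Context {R : realType}.
Implicit Types (z w c : plane R).

Definition maxq z : R := Num.max `|Re z| `|Im z|.

Lemma maxq_le z (r : R) : (maxq z <= r) = (`|Re z| <= r) && (`|Im z| <= r).
Proof. by rewrite /maxq ge_max. Qed.

Lemma maxq_lt z (r : R) : (maxq z < r) = (`|Re z| < r) && (`|Im z| < r).
Proof. by rewrite /maxq gt_max. Qed.

Lemma continuous_clip (f : R -> R) : continuous f ->
  continuous (fun t => Num.max (-1) (Num.min 1 (f t))).
Proof.
move=> cf t; apply: (@continuous_max _ _ (fun=> -1) (fun t => Num.min 1 (f t))).
  exact: cvg_cst.
by apply: (@continuous_min _ _ (fun=> 1) f); [exact: cvg_cst|exact: cf].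
Qed.

Lemma continuous_tent (a b c : R) : continuous (fun t : R => a + b * `|8 * t - c|).
Proof.
move=> t; apply: cvgD; first exact: cvg_cst.
apply: cvgM; first exact: cvg_cst.
apply: cvg_norm; apply: cvgB; last exact: cvg_cst.
by apply: cvgM; [exact: cvg_cst|exact: cvg_id].
Qed.

Let clip (v : R) := Num.max (-1) (Num.min 1 v).

Let clip_lo v : v <= -1 -> clip v = -1.
Proof. by move=> h; rewrite /clip min_r ?max_l //; lra. Qed.

Let clip_hi v : 1 <= v -> clip v = 1.
Proof. by move=> h; rewrite /clip min_l ?max_r //; lra. Qed.

Let clip_mid v : -1 <= v <= 1 -> clip v = v.
Proof. by move=> /andP[h1 h2]; rewrite /clip min_r ?max_r. Qed.

(* The boundary of the square is run through at constant speed from 1 - i;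
   the coordinates are tent functions clipped to [-1, 1]. *)
Lemma jordan_curve_square : jordan_curve [set z : plane R | maxq z = 1].
Proof.
pose x (t : R) := clip (-2 + 1 * `|8 * t - 5|).
pose y (t : R) := clip (2 + (-1) * `|8 * t - 3|).
have side1 t : 0 <= 8 * t <= 2 -> x t = 1 /\ y t = 8 * t - 1.
  move=> /andP[h0 h1]; rewrite /x /y !ler0_norm; [|lra..].
  by rewrite clip_hi 1?clip_mid; [split; lra|lra..].
have side2 t : 2 <= 8 * t <= 4 -> x t = 3 - 8 * t /\ y t = 1.
  move=> /andP[h0 h1]; rewrite /x /y (@ler0_norm _ (_ - 5)); last lra.
  rewrite clip_mid ?clip_hi; [split; lra|idtac|lra].
  by have := ler_norm (3 - 8 * t); have := ler_norm (8 * t - 3);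
     case: (ger0P (8 * t - 3)) => ? ? ?; lra.
have side3 t : 4 <= 8 * t <= 6 -> x t = -1 /\ y t = 5 - 8 * t.
  move=> /andP[h0 h1]; rewrite /x /y (@ger0_norm _ (_ - 3)); last lra.
  rewrite clip_lo ?clip_mid; [split; lra|lra|idtac].
  by case: (ger0P (8 * t - 5)) => ?; lra.
have side4 t : 6 <= 8 * t <= 8 -> x t = 8 * t - 7 /\ y t = -1.
  move=> /andP[h0 h1]; rewrite /x /y !ger0_norm; [|lra..].
  by rewrite clip_mid 1?clip_lo; [split; lra|lra..].
(* Each side takes a quarter of the parameter interval and is traversed affinely in 8 t. *)
have sides t : 0 <= t <= 1 ->
    [\/ [/\ 0 <= 8 * t <= 2, x t = 1 & y t = 8 * t - 1],
        [/\ 2 <= 8 * t <= 4, x t = 3 - 8 * t & y t = 1],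
        [/\ 4 <= 8 * t <= 6, x t = -1 & y t = 5 - 8 * t] |
        [/\ 6 <= 8 * t <= 8, x t = 8 * t - 7 & y t = -1] ].
  move=> /andP[t0 t1].
  have [h2|h2] := orP (le_total (8 * t) 2).
    have h : 0 <= 8 * t <= 2 by lra.
    by have [? ?] := side1 _ h; apply: Or41.
  have [h4|h4] := orP (le_total (8 * t) 4).
    have h : 2 <= 8 * t <= 4 by lra.
    by have [? ?] := side2 _ h; apply: Or42.
  have [h6|h6] := orP (le_total (8 * t) 6).
    have h : 4 <= 8 * t <= 6 by lra.
    by have [? ?] := side3 _ h; apply: Or43.
  have h : 6 <= 8 * t <= 8 by lra.
  by have [? ?] := side4 _ h; apply: Or44.
exists (fun t => (x t +i* y t)%C); split.
- apply: continuous_subspaceT; apply: continuous_plane;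
  by apply: continuous_clip; exact: continuous_tent.
- have [] := side1 0; first by lra.
  by have [] := side4 1; [lra|move=> -> -> -> ->; congr (_ +i* _)%C; lra].
- move=> s t; rewrite !in_itv /= => /andP[s0 s1] /andP[t0 t1] [].
  have hs : 0 <= s <= 1 by rewrite s0 ltW.
  have ht : 0 <= t <= 1 by rewrite t0 ltW.
  move: (sides _ hs) (sides _ ht) => {side1 side2 side3 side4 sides hs ht}.
  by case=> -[/andP[? ?] -> ->]; case=> -[/andP[? ?] -> ->]; lra.
- apply/seteqP; split=> [[a b] /= ab1|_ [t + <-]]; last first.
    rewrite /= in_itv /= => /sides h; rewrite /maxq /=; case: h => -[/andP[? ?] -> ->].
    + by rewrite normr1 max_l // ler_norml; lra.
    + by rewrite normr1 max_r // ler_norml; lra.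
    + by rewrite normrN1 max_l // ler_norml; lra.
    + by rewrite normrN1 max_r // ler_norml; lra.
  have : maxq (a +i* b)%C <= 1 by rewrite ab1.
  rewrite maxq_le /= !ler_norml => /andP[/andP[a0 a1] /andP[b0 b1]].
  (* The parameter is found by inverting the affine formula of a side containing the point; a point
     on no side would have [maxq] below 1. *)
  have [t [t01 xt yt]] : exists t, [/\ 0 <= t <= 1, x t = a & y t = b].
    have [a1'|a1'] := eqVneq a 1.
      exists ((b + 1) / 8); by have [|-> ->] := side1 ((b + 1) / 8); [lra|split; lra].
    have [a2'|a2'] := eqVneq a (-1).
      exists ((5 - b) / 8); by have [|-> ->] := side3 ((5 - b) / 8); [lra|split; lra].
    have [b1'|b1'] := eqVneq b 1.
      exists ((3 - a) / 8); by have [|-> ->] := side2 ((3 - a) / 8); [lra|split; lra].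
    have [b2'|b2'] := eqVneq b (-1).
      exists ((7 + a) / 8); by have [|-> ->] := side4 ((7 + a) / 8); [lra|split; lra].
    have : maxq (a +i* b)%C < 1.
      rewrite maxq_lt /= !ltr_norml !lt_neqAle.
      by rewrite eq_sym a2' a1' eq_sym b2' b1' a0 a1 b0 b1.
    by rewrite ab1 ltxx.
  by exists t; rewrite ?xt ?yt //= in_itv.
Qed.

Lemma gauge_maxq : gauge (@maxq).
Proof.
split.
- move=> z; apply: (@continuous_max _ _ (fun z : plane R => `|Re z|) (fun z : plane R => `|Im z|)).
    by apply: cvg_norm; exact: continuous_Re.
  by apply: cvg_norm; exact: continuous_Im.
- move=> a z a0; rewrite /maxq scale_Re scale_Im !normrM (ger0_norm a0).
  by rewrite maxr_pMr.
- move=> z w; rewrite maxq_le add_Re add_Im /maxq.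
  apply/andP; split; apply: le_trans (ler_normD _ _) _; apply: lerD;
  by rewrite le_max lexx ?orbT.
- by move=> z; rewrite /maxq le_max lexx.
- by move=> z; rewrite /maxq le_max lexx orbT.
- exact: jordan_curve_square.
Qed.

End MaxGauge.

(** * The modulus and round disks *)

Section RoundGauge.
Context {R : realType}.
Implicit Types (z w c : plane R).

(** The modulus as an element of [R]; the norm of the plane takes its values in [R[i]]. *)
Definition absq z : R := Num.sqrt (Re z ^+ 2 + Im z ^+ 2).

Lemma normC_absq z : `|z| = (absq z)%:C%C.
Proof. exact: normC_def. Qed.

(* The unit circle is run through from 1 with the abscissa as parameter; [min]
   and [max] freeze the half of the circle that is not being traversed. *)
Lemma jordan_curve_circle : jordan_curve [set z : plane R | absq z = 1].
Proof.
pose h : R := 2^-1.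
pose x (t : R) : R := 4 * `|t - h| - 1.
pose arc (t : R) : R := Num.sqrt (1 - x t ^+ 2).
pose y (t : R) : R := arc (Num.min t h) - arc (Num.max t h).
have xlo t : t <= h -> x t = 1 - 4 * t.
  by move=> th; rewrite /x ler0_norm; rewrite /h in th *; lra.
have xhi t : h <= t -> x t = 4 * t - 3.
  by move=> th; rewrite /x ger0_norm; rewrite /h in th *; lra.
have arch : arc h = 0.
  by rewrite /arc xlo // ler0_sqrtr // /h; lra.
have ylo t : t <= h -> y t = arc t.
  by move=> th; rewrite /y min_l // max_r // arch subr0.
have yhi t : h <= t -> y t = - arc t.
  by move=> th; rewrite /y min_r // max_l // arch sub0r.
have arc_ge0 t : 0 <= arc t by exact: sqrtr_ge0.
have xc : continuous x.
  move=> t; apply: cvgB; last exact: cvg_cst.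
  apply: cvgM; first exact: cvg_cst.
  by apply: cvg_norm; apply: cvgB; [exact: cvg_id|exact: cvg_cst].
have arcc : continuous arc.
  move=> t; apply: (@continuous_comp _ _ _ (fun t => 1 - x t ^+ 2) Num.sqrt).
    by apply: cvgB; [exact: cvg_cst|apply: cvgM; exact: xc].
  exact: sqrt_continuous.
have yc : continuous y.
  move=> t; apply: cvgB.
    apply: (@continuous_comp _ _ _ (fun t => Num.min t h) arc); last exact: arcc.
    by apply: (@continuous_min _ _ id (fun=> h)); [exact: cvg_id|exact: cvg_cst].
  apply: (@continuous_comp _ _ _ (fun t => Num.max t h) arc); last exact: arcc.
  by apply: (@continuous_max _ _ id (fun=> h)); [exact: cvg_id|exact: cvg_cst].
have x01 t : 0 <= t <= 1 -> x t ^+ 2 <= 1.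
  move=> /andP[t0 t1]; have [th|th] := orP (le_total t h).
    by rewrite xlo //; rewrite /h in th; nra.
  by rewrite xhi //; rewrite /h in th; nra.
have xy1 t : 0 <= t <= 1 -> x t ^+ 2 + y t ^+ 2 = 1.
  move=> t01; have -> : y t ^+ 2 = arc t ^+ 2.
    have [th|th] := orP (le_total t h); first by rewrite ylo.
    by rewrite yhi // sqrrN.
  by rewrite sqr_sqrtr ?subr_ge0 ?x01 // addrC subrK.
(* A common point of the two half circles has ordinate 0, hence abscissa 1 or -1. Abscissa 1 would
   need s = 0 and t = 1, which is excluded; abscissa -1 gives s = t = 1/2. *)
have cross s t : 0 <= s < 1 -> 0 <= t < 1 -> s <= h -> h <= t -> x s = x t ->
    y s = y t -> s = t.
  move=> s01 t01 sh ht xst yst.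
  have arc0 : arc s = 0.
    have := arc_ge0 s; have := arc_ge0 t.
    by move: yst; rewrite ylo // yhi //; lra.
  have : x s ^+ 2 + y s ^+ 2 = 1.
    by apply: xy1; move: s01 => /andP[-> /ltW].
  rewrite ylo // arc0 expr0n addr0 => /eqP.
  rewrite sqrf_eq1 => /orP[] /eqP; move: xst; rewrite xlo // xhi //;
  by rewrite /h in sh ht; move: s01 t01 => /andP[? ?] /andP[? ?]; lra.
exists (fun t => (x t +i* y t)%C); split.
- by apply: continuous_subspaceT; exact: continuous_plane.
- have h0 : 0 <= h by rewrite /h; lra.
  have h1 : h <= 1 by rewrite /h; lra.
  congr (_ +i* _)%C; first by rewrite xlo // xhi //; lra.
  rewrite ylo // yhi // /arc xlo // xhi //.
  have -> : 1 - (1 - 4 * 0) ^+ 2 = 0 :> R by ring.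
  have -> : 1 - (4 * 1 - 3) ^+ 2 = 0 :> R by ring.
  by rewrite sqrtr0 oppr0.
- move=> s t; rewrite !in_itv /= => s01 t01 [xst yst].
  have [sh|sh] := orP (le_total s h); have [th|th] := orP (le_total t h).
  + by move: xst; rewrite !xlo //; lra.
  + exact: cross.
  + by apply/esym; exact: cross.
  + by move: xst; rewrite !xhi //; lra.
- apply/seteqP; split=> [[a b] /= ab1|_ [t + <-]]; last first.
    by rewrite /= in_itv /= /absq /= => /xy1 ->; rewrite sqrtr1.
  have {}ab1 : a ^+ 2 + b ^+ 2 = 1.
    rewrite -[LHS]sqr_sqrtr ?addr_ge0 ?sqr_ge0 //.
    by move: ab1; rewrite /absq /= => ->; rewrite expr1n.
  have b2 : 1 - a ^+ 2 = b ^+ 2 by rewrite -ab1 addrC addKr.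
  have /andP[a0 a1] : -1 <= a <= 1 by apply/andP; split; nra.
  have [b0|b0] := orP (le_total 0 b).
    have th : (1 - a) / 4 <= h by rewrite /h; lra.
    have xa : x ((1 - a) / 4) = a by rewrite xlo //; lra.
    exists ((1 - a) / 4); first by rewrite /= in_itv /=; lra.
    by rewrite xa ylo // /arc xa b2 sqrtr_sqr ger0_norm.
  have th : h <= (a + 3) / 4 by rewrite /h; lra.
  have xa : x ((a + 3) / 4) = a by rewrite xhi //; lra.
  exists ((a + 3) / 4); first by rewrite /= in_itv /=; lra.
  by rewrite xa yhi // /arc xa b2 sqrtr_sqr ler0_norm // opprK.
Qed.

Lemma gauge_absq : gauge (@absq).
Proof.
split.
- move=> z; apply: (@continuous_comp _ _ _ (fun z : plane R => Re z ^+ 2 + Im z ^+ 2) Num.sqrt).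
    by apply: cvgD; apply: cvgM; (exact: continuous_Re || exact: continuous_Im).
  exact: sqrt_continuous.
- move=> a z a0; rewrite /absq scale_Re scale_Im.
  by rewrite !exprMn -mulrDr sqrtrM ?sqr_ge0 // sqrtr_sqr ger0_norm.
- by move=> z w; rewrite -lecR rmorphD /= -!normC_absq ler_normD.
- by move=> z; rewrite /absq -sqrtr_sqr ler_sqrt ?addr_ge0 ?sqr_ge0 // lerDl sqr_ge0.
- by move=> z; rewrite /absq -sqrtr_sqr ler_sqrt ?addr_ge0 ?sqr_ge0 // lerDr sqr_ge0.
- exact: jordan_curve_circle.
Qed.

End RoundGauge.

(** * Box mappings with univalent branches *)

Section Components.
Context {R : realType}.

Lemma component_connected_set (A W : set (plane R)) : connected A ->
  component A W -> W = A.
Proof.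
move=> cA [x Ax ->]; apply/seteqP; split; first exact: connected_component_sub.
exact: connected_component_max.
Qed.

Lemma connected_component_set (A : set (plane R)) : A !=set0 -> connected A ->
  component A A.
Proof.
move=> [x Ax] cA; exists x => //; apply/seteqP; split.
  exact: connected_component_max.
exact: connected_component_sub.
Qed.

(** In the component of a point of [U_ i], the set [U_ i] is open, and closed because the other sets
    have an open union; so it is the whole component. *)
Lemma component_bigcup (I : Type) (U_ : I -> set (plane R)) (W : set (plane R)) :
  (forall i, open (U_ i)) -> (forall i, connected (U_ i)) ->
  (forall i j, U_ i `&` U_ j !=set0 -> i = j) ->
  component (\bigcup_i U_ i) W -> exists i, W = U_ i.
Proof.
move=> oU cU dU [x [i _ Uix] ->]; exists i; set A := \bigcup_i _.
have Ui : U_ i `<=` connected_component A x.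
  by apply: connected_component_max => // y Uiy; exists i.
apply/seteqP; split=> //.
set C := connected_component A x.
have CA : C `<=` A by exact: connected_component_sub.
suff <- : C `&` U_ i = C by move=> y [].
have := @component_connected _ A x; apply.
- by exists x; split=> //; apply: connected_component_refl; exists i.
- by exists (U_ i).
- exists (~` \bigcup_(j in [set j | j <> i]) U_ j).
    by apply: open_closedC; apply: bigcup_open.
  apply/seteqP; split=> y [Cy yU]; split=> //.
    by move=> [j /= ji Ujy]; apply: ji; apply: dU; exists y.
  have [j _ Ujy] := CA _ Cy.
  have [<-//|ji] := pselect (j = i).
  by case: yU; exists j.
Qed.

Lemma jordan_disk_connected (A : set (plane R)) : jordan_disk A -> connected A.
Proof. by move=> [[_ [_ pA _]] _]; exact: path_connected_connected. Qed.

End Components.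

Lemma conj_invariantP (R : realType) (A : set (plane R)) :
  (forall z, A z -> A (conjc z)) -> conj_invariant A.
Proof.
move=> h; apply/seteqP; split=> [_ [z Az <-]|z Az]; first exact: h.
by exists (conjc z); [exact: h|rewrite conjcK].
Qed.

(** * Gluing univalent branches into a box mapping *)

Section Glue.
Context {R : realType} {I : Type}.
Variables (V : set (plane R)) (U_ : I -> set (plane R))
  (f_ g_ : I -> plane R -> plane R).

Definition glue_dom : set (plane R) := \bigcup_i U_ i.

(** The identity is a dummy value off the domain. The index chosen on the domain is immaterial once
    the pieces are disjoint. *)
Definition glue (z : plane R) : plane R :=
  if pselect (exists i, U_ i z) is left e then f_ (projT1 (cid e)) z else z.

(** Each [f_ i] is a univalent map of [U_ i] onto the single disk [V], with inverse [g_ i];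
    continuity of the inverse yields properness. Disjointness of the closures is phrased as
    uniqueness of the index. *)
Record univalent_branches : Prop := UnivalentBranches {
  ub_inhabited : inhabited I;
  ub_cod : jordan_disk V;
  ub_dom : forall i, jordan_disk (U_ i);
  ub_disjoint : forall i j, closure (U_ i) `&` closure (U_ j) !=set0 -> i = j;
  ub_compact : forall i, compactly_contained (U_ i) V;
  ub_derivable : forall i z, U_ i z -> derivable (f_ i) z 1;
  ub_derive_neq0 : forall i z, U_ i z -> 'D_1 (f_ i) z <> 0;
  ub_f : forall i z, U_ i z -> V (f_ i z);
  ub_g : forall i w, V w -> U_ i (g_ i w);
  ub_gf : forall i z, U_ i z -> g_ i (f_ i z) = z;
  ub_fg : forall i w, V w -> f_ i (g_ i w) = w;
  ub_g_continuous : forall i w, V w -> {for w, continuous (g_ i)}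
}.

Hypothesis ub : univalent_branches.

Lemma ub_uniq i j z : U_ i z -> U_ j z -> i = j.
Proof.
by move=> Ui Uj; apply: (ub_disjoint ub); exists z; split; exact: subset_closure.
Qed.

Lemma ub_open i : open (U_ i).
Proof. by have [[]] := ub_dom ub i. Qed.

Lemma glueE i z : U_ i z -> glue z = f_ i z.
Proof.
move=> Uiz; rewrite /glue; case: pselect => [e|[]]; last by exists i.
by case: (cid e) => j /= Ujz; rewrite (ub_uniq Ujz Uiz).
Qed.

Lemma derivable_glue i z : U_ i z -> derivable glue z 1.
Proof.
move=> Uiz; apply: (near_eq_derivable _ (ub_derivable ub Uiz)).
have : nbhs z (U_ i) by exact: (open_nbhs_nbhs (conj (@ub_open i) Uiz)).
by apply: filterS => y Uiy; rewrite (glueE Uiy).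
Qed.

Lemma derive_glue i z : U_ i z -> 'D_1 glue z = 'D_1 (f_ i) z.
Proof.
move=> Uiz; apply: near_eq_derive.
have : nbhs z (U_ i) by exact: (open_nbhs_nbhs (conj (@ub_open i) Uiz)).
by apply: filterS => y; exact: glueE.
Qed.

Lemma glue_dom_sub : glue_dom `<=` V.
Proof.
by move=> z [i _ Uiz]; have [_] := ub_compact ub i; apply; exact: subset_closure.
Qed.

Lemma critical_glue : critical glue_dom glue = set0.
Proof.
rewrite -subset0 => z [[i _ Uiz]]; rewrite (derive_glue Uiz).
exact: (ub_derive_neq0 ub).
Qed.

Lemma component_glue_dom W : component glue_dom W -> exists i, W = U_ i.
Proof.
apply: component_bigcup; first exact: ub_open.
  by move=> i; apply: jordan_disk_connected; exact: (ub_dom ub).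
by move=> i j [z []]; exact: ub_uniq.
Qed.

Lemma glue_image i : glue @` U_ i = V.
Proof.
apply/seteqP; split=> [_ [z Uiz <-]|w Vw].
  by rewrite (glueE Uiz); exact: (ub_f ub).
have Ug := ub_g ub i Vw.
by exists (g_ i w) => //; rewrite (glueE Ug) (ub_fg ub).
Qed.

Lemma glue_box_mapping : complex_box_mapping glue_dom V glue.
Proof.
have cV := jordan_disk_connected (ub_cod ub).
have [[oV [V0 _ _]] _] := ub_cod ub.
split=> //.
- by apply: bigcup_open => i _; exact: ub_open.
- have [k] := ub_inhabited ub; have [[_ [[z Ukz] _ _]] _] := ub_dom ub k.
  by exists z, k.
- exact: glue_dom_sub.
- move=> _ [z [i _ Uiz] <-]; rewrite (glueE Uiz); exact: (ub_f ub).
- by move=> z [i _]; exact: derivable_glue.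
- by rewrite critical_glue.
- exists [set V]; split; [exact: finite_set1| |by rewrite bigcup_set1].
  split; first by move=> A ->; exact: (ub_cod ub).
  by move=> A B /= -> ->.
- move=> W /(component_connected_set cV) ->; right.
  exists (range U_); split.
  + split; first by move=> _ [i _ <-]; exact: (ub_dom ub).
    move=> _ _ [i _ <-] [j _ <-] ij.
    by rewrite (ub_disjoint ub ij).
  + by move=> _ [i _ <-]; exact: (ub_compact ub).
  + rewrite (setIidr glue_dom_sub).
    apply/seteqP; split=> [z [i _ Uiz]|z [_ [i _ <-] Uiz]]; last by exists i.
    by exists (U_ i) => //; exists i.
- move=> W /component_glue_dom [i ->]; rewrite glue_image; split.
    exact: connected_component_set.
  move=> K cK; rewrite glue_image => KV.
  (* Properness: the preimage of [K] in [U_ i] is the image of [K] by the continuous inverse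
     branch. *)
  have -> : U_ i `&` glue @^-1` K = g_ i @` K.
    apply/seteqP; split=> [z [Uiz /=]|_ [w Kw <-]].
      rewrite (glueE Uiz) => Kf; exists (f_ i z) => //; exact: (ub_gf ub).
    have Ug := ub_g ub i (KV _ Kw); split=> //=.
    by rewrite (glueE Ug) (ub_fg ub) //; exact: KV.
  apply: continuous_compact => //; apply: continuous_in_subspaceT => w.
  by rewrite inE => /KV; exact: (ub_g_continuous ub).
Qed.

(** [s] is the action of complex conjugation on the indices of the components. *)
Lemma glue_symmetric (s : I -> I) : conj_invariant V ->
  (forall i z, U_ i z -> U_ (s i) (conjc z)) ->
  (forall i z, U_ i z -> f_ (s i) (conjc z) = conjc (f_ i z)) ->
  real_symmetric glue_dom V glue.
Proof.
move=> sV sU sf; split=> //.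
- apply/seteqP; split=> [_ [z [i _ Uiz] <-]|z [i _ Uiz]].
    by exists (s i) => //; exact: sU.
  by exists (conjc z); rewrite ?conjcK //; exists (s i) => //; exact: sU.
- by move=> z [i _ Uiz]; rewrite (glueE Uiz) (glueE (sU _ _ Uiz)) sf.
Qed.

End Glue.

(** * Complex derivatives *)

Section Derivatives.
Context {R : realType}.

(* Carathéodory's criterion. *)
Lemma plane_derive (f phi : plane R -> plane R) (z : plane R) :
  phi @ nbhs z --> phi z ->
  (\forall w \near z, f w - f z = (w - z) * phi w) ->
  derivable f z 1 /\ 'D_1 f z = phi z.
Proof.
move=> phic fphi.
have shc : (fun h : plane R => h + z) @ nbhs (0 : plane R) --> z.
  rewrite -[X in _ --> X](add0r z).
  by apply: plane_cvgD; [exact: plane_cvg_id|exact: plane_cvg_cst].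
have lim0 : (fun h : plane R => h^-1 *: ((f \o shift z) (h *: (1 : plane R)) - f z))
    @ (0 : plane R)^' --> phi z.
  have : (fun h : plane R => phi (h + z)) @ nbhs (0 : plane R) --> phi z.
    exact: cvg_comp shc phic.
  move=> h1 P Pz.
  have h2 := shc _ fphi; have h3 := h1 P Pz.
  suff : \forall h \near (0 : plane R), h != 0 ->
      P (h^-1 *: ((f \o shift z) (h *: (1 : plane R)) - f z)) by [].
  apply: (@filterS2 _ _ (plane_nbhs_filter (0 : plane R)) _ _ _ _ h2 h3) => h /= e Ph h0.
  rewrite [h *: 1]mulr1 e addrK.
  by rewrite [X in P X]mulrA mulVf // mul1r.
split; first by apply/cvg_ex; exists (phi z).
exact: cvg_lim.
Qed.

End Derivatives.

(** * Real Möbius maps and disks with real diameter *)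

Section RealDisks.
Context {R : realType}.
Implicit Types (z w c : plane R) (s t p q : R).

(* The round disk having the real segment [s, t] as a diameter. *)
Definition rdisk s t : set (plane R) :=
  [set z | Im z ^+ 2 < (Re z - s) * (t - Re z)].

Definition crdisk s t : set (plane R) :=
  [set z | Im z ^+ 2 <= (Re z - s) * (t - Re z)].

(** Both sides are the opposite of the power of [z] with respect to the circle with diameter [s, t];
    this turns [rdisk] into a ball of the modulus. *)
Let rdisk_num s t z :
  (Re z - s) * (t - Re z) - Im z ^+ 2 =
  ((t - s) / 2) ^+ 2 - (absq (z - ((s + t) / 2)%:C%C)) ^+ 2.
Proof.
rewrite /absq sqr_sqrtr ?addr_ge0 ?sqr_ge0 // sub_Re sub_Im /=.
by field.
Qed.

Lemma rdisk_gball s t : s < t ->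
  rdisk s t = gball absq ((s + t) / 2)%:C%C ((t - s) / 2).
Proof.
move=> st; apply/seteqP; split=> z; rewrite /rdisk /gball /= -subr_gt0 rdisk_num;
  rewrite subr_gt0 ltr_pXn2r ?nnegrE ?sqrtr_ge0 //; lra.
Qed.

Lemma crdisk_cgball s t : s < t ->
  crdisk s t = cgball absq ((s + t) / 2)%:C%C ((t - s) / 2).
Proof.
move=> st; apply/seteqP; split=> z; rewrite /crdisk /cgball /= -subr_ge0 rdisk_num;
  rewrite subr_ge0 ler_pXn2r ?nnegrE ?sqrtr_ge0 //; lra.
Qed.

Lemma jordan_disk_rdisk s t : s < t -> jordan_disk (rdisk s t).
Proof.
move=> st; rewrite rdisk_gball //; apply: jordan_disk_gball; first exact: gauge_absq.
lra.
Qed.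

Lemma closure_rdisk s t : s < t -> closure (rdisk s t) = crdisk s t.
Proof.
move=> st; rewrite rdisk_gball // crdisk_cgball //.
by apply: closure_gball; [exact: gauge_absq|lra].
Qed.

Lemma compact_crdisk s t : s < t -> compact (crdisk s t).
Proof.
by move=> st; rewrite crdisk_cgball //; apply: compact_cgball; exact: gauge_absq.
Qed.

Lemma crdisk_Re s t z : s < t -> crdisk s t z -> s <= Re z <= t.
Proof. by rewrite /crdisk /= => st h; have := sqr_ge0 (Im z); nra. Qed.

Lemma sub_rdisk s t s' t' : s < t -> s' <= s -> t <= t' -> rdisk s t `<=` rdisk s' t'.
Proof.
move=> st ss tt z h; have /crdisk_Re : crdisk s t z by exact: ltW.
move=> /(_ st) /andP[h1 h2]; move: h; rewrite /rdisk /= => h.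
by apply: lt_le_trans h _; nra.
Qed.

Lemma compactly_contained_rdisk s t s' t' : s < t -> s' < s -> t < t' ->
  compactly_contained (rdisk s t) (rdisk s' t').
Proof.
move=> st ss tt; rewrite /compactly_contained closure_rdisk //.
split; first exact: compact_crdisk.
move=> z h; have /andP[h1 h2] := crdisk_Re st h; move: h; rewrite /crdisk /rdisk /= => h.
by apply: le_lt_trans h _; nra.
Qed.

Lemma rdisk_conjc s t z : rdisk s t z -> rdisk s t (conjc z).
Proof. by case: z => x y; rewrite /rdisk /= sqrrN. Qed.

End RealDisks.

(** * Möbius maps with real coefficients *)

Section Mobius.
Context {R : realType}.
Implicit Types (z w : plane R) (a b c d s t : R).

Definition den c d z : plane R := c%:C%C * z + d%:C%C.

Definition mob a b c d z : plane R := (a%:C%C * z + b%:C%C) / den c d z.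

(** The inverse map is given by the adjugate matrix; the determinant cancels in the quotient. *)
Lemma mob_inv a b c d z : a * d - b * c != 0 -> den c d z != 0 ->
  mob d (- b) (- c) a (mob a b c d z) = z.
Proof.
move=> D0 n0; rewrite /mob; set n := den c d z in n0 *.
have DC0 : a%:C%C * d%:C%C - b%:C%C * c%:C%C != 0 :> R[i].
  by rewrite -!rmorphM -rmorphB; apply/eqP => /complexI /eqP; apply/negP.
have e1 : d%:C%C * ((a%:C%C * z + b%:C%C) / n) + (- b)%:C%C =
    z * (a%:C%C * d%:C%C - b%:C%C * c%:C%C) / n.
  apply: (mulIf n0); rewrite mulrDl mulfVK // -mulrA mulfVK // rmorphN /n /den.
  ring.
have e2 : den (- c) a ((a%:C%C * z + b%:C%C) / n) =
    (a%:C%C * d%:C%C - b%:C%C * c%:C%C) / n.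
  rewrite /den; apply: (mulIf n0); rewrite mulrDl mulfVK // -mulrA mulfVK // rmorphN /n /den.
  ring.
by rewrite e1 e2 -mulrA mulfK // mulf_neq0 // invr_eq0.
Qed.

(** The difference quotient between w and z is exactly (ad - bc) / ([den] w [den] z), which is
    continuous in w at z. *)
Lemma mob_derive a b c d z : den c d z != 0 ->
  derivable (mob a b c d) z 1 /\
  'D_1 (mob a b c d) z = (a * d - b * c)%:C%C / (den c d z * den c d z).
Proof.
move=> n0.
have denc : den c d @ nbhs z --> (den c d z : plane R).
  apply: plane_cvgD; last exact: plane_cvg_cst.
  by apply: plane_cvgM; [exact: plane_cvg_cst|exact: plane_cvg_id].
apply: (@plane_derive _ _ (fun w => (a * d - b * c)%:C%C / (den c d w * den c d z))).
  apply: plane_cvgM; first exact: plane_cvg_cst.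
  apply: plane_cvgV; first by rewrite mulf_neq0.
  by apply: plane_cvgM => //; exact: plane_cvg_cst.
have near0 : \forall w \near z, den c d w != 0.
  exact: (plane_cvg_neq0 denc n0).
apply: (@filterS _ _ (plane_nbhs_filter z) _ _ _ near0) => w m0.
rewrite /mob; set m := den c d w in m0 *; set n := den c d z in n0 *.
apply: (mulIf m0); apply: (mulIf n0).
have -> : ((a%:C%C * w + b%:C%C) / m - (a%:C%C * z + b%:C%C) / n) * m * n =
    (a%:C%C * w + b%:C%C) * n - (a%:C%C * z + b%:C%C) * m :> R[i] by field; apply/andP.
have -> : (w - z) * ((a * d - b * c)%:C%C / (m * n)) * m * n =
    (w - z) * (a * d - b * c)%:C%C :> R[i] by field; apply/andP.
rewrite rmorphB !rmorphM /m /n /den; ring.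
Qed.

Lemma mob_conjc a b c d z : mob a b c d (conjc z) = conjc (mob a b c d z).
Proof.
have J k l : k%:C%C * conjc z + l%:C%C = conjc (k%:C%C * z + l%:C%C) :> R[i].
  by case: (z) => x y; apply: plane_ext => /=; ring.
by rewrite /mob /den !J rmorphM fmorphV.
Qed.

(** The real part of the denominator is affine in [Re z] and positive at both ends of [s, t], hence
    positive on the disk. *)
Lemma den_neq0 c d s t z : s < t -> 0 < c * s + d -> 0 < c * t + d ->
  crdisk s t z -> den c d z != 0.
Proof.
move=> st cs ct zst; apply/eqP => /(congr1 (@complex.Re R)).
rewrite /den add_Re scale_Re /= => e.
have /andP[h1 h2] := crdisk_Re st zst.
have [c0|c0] := orP (le_total 0 c); nra.
Qed.

(* The power of Mz with respect to [Ms, Mt] is a positive multiple of that of z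
   with respect to [s, t]. *)
Lemma mob_rdisk a b c d s t z : s < t -> a * d - b * c != 0 ->
  0 < c * s + d -> 0 < c * t + d -> rdisk s t z ->
  rdisk ((a * s + b) / (c * s + d)) ((a * t + b) / (c * t + d)) (mob a b c d z).
Proof.
move=> st D0 cs ct zst.
have n0 : den c d z != 0 by apply: den_neq0 cs ct _ => //; exact: ltW.
case: z zst n0 => x y zst n0; rewrite /rdisk /= in zst.
(* [N] is the squared modulus of the denominator; multiplying by the conjugate denominator separates
   the real and imaginary parts. *)
pose N := (c * x + d) ^+ 2 + (c * y) ^+ 2.
have N0 : 0 < N.
  rewrite lt_neqAle addr_ge0 ?sqr_ge0 // andbT eq_sym.
  apply: contraNN n0; rewrite /N paddr_eq0 ?sqr_ge0 // !sqrf_eq0 => /andP[/eqP e1 /eqP e2].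
  by rewrite /den eq_complex /= mul0r subr0 mul0r addr0 addr0 e1 e2 eqxx.
have NN := lt0r_neq0 N0.
have e : mob a b c d (x +i* y)%C =
   ((((a * x + b) * (c * x + d) + a * c * y ^+ 2) / N) +i*
    ((a * d - b * c) * y / N))%C.
  rewrite /mob; apply: (mulIf n0); rewrite mulfVK //.
  have key1 (X W u v : R) : X / N * u - W / N * v = (X * u - W * v) / N by field.
  have key2 (X W u v : R) : X / N * v + W / N * u = (X * v + W * u) / N by field.
  apply: plane_ext; rewrite /den /= ?key1 ?key2; apply: (mulIf NN);
    rewrite mulfVK // /N; ring.
rewrite e /rdisk /= -subr_gt0.
have cs0 := lt0r_neq0 cs; have ct0 := lt0r_neq0 ct.
have -> : (((a * x + b) * (c * x + d) + a * c * y ^+ 2) / N - (a * s + b) / (c * s + d)) *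
    ((a * t + b) / (c * t + d) - ((a * x + b) * (c * x + d) + a * c * y ^+ 2) / N) -
    ((a * d - b * c) * y / N) ^+ 2 =
    (a * d - b * c) ^+ 2 * ((x - s) * (t - x) - y ^+ 2) /
      (N * (c * s + d) * (c * t + d)).
  by move: NN; rewrite /N => NN; field; apply/and3P.
apply: divr_gt0; last by rewrite !mulr_gt0.
by apply: mulr_gt0; [rewrite exprn_even_gt0|rewrite subr_gt0].
Qed.

End Mobius.

(** * A box mapping all of whose components contain wandering disks *)

Section FilledJulia.
Context {R : realType}.
Variables (U V : set (plane R)) (F : plane R -> plane R).
Hypothesis UV : U `<=` V.

(** The condition of level n + 1 at [z] is [U z] together with the condition of level n at [F z];
    level 0 follows from the inclusion of [U] in [V]. *)
Lemma filled_juliaE z :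
  filled_julia U V F z <-> U z /\ filled_julia U V F (F z).
Proof.
split=> [Kz|[Uz KFz] [|n] _ /=]; [|exact: UV|by split=> //; exact: KFz].
by split=> [|n _]; [have [] := Kz 1%N I|have [] := Kz n.+1 I].
Qed.

Lemma filled_julia_sub : filled_julia U V F `<=` U.
Proof. by move=> z /filled_juliaE[]. Qed.

Lemma filled_julia_iter z n : filled_julia U V F z ->
  filled_julia U V F (iter n F z).
Proof. by move=> Kz; elim: n => //= n /filled_juliaE[]. Qed.

Lemma filled_julia_ge (B : set (plane R)) : B `<=` U -> F @` B `<=` B ->
  B `<=` filled_julia U V F.
Proof.
move=> BU FB z Bz n _; elim: n z Bz => [|n IH] z Bz /=; first exact/UV/BU.
by split; [exact: BU|apply: IH; apply: FB; exists z].
Qed.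

End FilledJulia.

(** * A Möbius branch from a disk onto the disk with diameter [0, 1] *)

Section MobiusBranch.
Context {R : realType}.
Variables (s t l : R).
Hypotheses (st : s < t) (l0 : 0 < l).

(* The real Möbius map (z - s) / (t - z) |-> l (z - s) / (t - z) followed by
   u |-> u / (1 + u); it maps [s, t] onto [0, 1]. *)
Definition mobF : plane R -> plane R := mob l (- (l * s)) (l - 1) (t - l * s).

(** The adjugate of the matrix of [mobF], with the signs in the form given by [mob_inv]. *)
Definition mobG : plane R -> plane R :=
  mob (t - l * s) (- - (l * s)) (- (l - 1)) l.

Let det_neq0 : l * (t - l * s) - - (l * s) * (l - 1) != 0.
Proof.
have -> : l * (t - l * s) - - (l * s) * (l - 1) = l * (t - s) by ring.
by rewrite mulf_neq0 ?gt_eqF // subr_gt0.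
Qed.

Let detG_neq0 : (t - l * s) * l - - - (l * s) * - (l - 1) != 0.
Proof.
by have -> : (t - l * s) * l - - - (l * s) * - (l - 1) =
  l * (t - l * s) - - (l * s) * (l - 1) by ring.
Qed.

Let den_pos p : s <= p <= t -> 0 < (l - 1) * p + (t - l * s).
Proof.
move=> /andP[h1 h2]; have -> : (l - 1) * p + (t - l * s) = l * (p - s) + (t - p) by ring.
move: h2; rewrite le_eqVlt => /predU1P[->|h2].
  by rewrite subrr addr0 mulr_gt0 // subr_gt0.
by rewrite ltr_wpDl ?subr_gt0 // mulr_ge0 ?subr_ge0 // ltW.
Qed.

Let den_neq0F z : crdisk s t z -> den (l - 1) (t - l * s) z != 0.
Proof. by apply: den_neq0 => //; apply: den_pos; rewrite ?lexx ltW. Qed.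

Let den_neq0G z : rdisk 0 1 z -> den (- (l - 1)) l z != 0.
Proof.
have := l0 => l0' h; apply: (@den_neq0 _ _ _ 0 1); [exact: ltr01| | |exact: ltW].
  by rewrite mulr0 add0r.
by rewrite mulr1 opprB subrK.
Qed.

(** The image endpoints are written without dividing by t - p or t - q, so that q = t is allowed. *)
Lemma mobF_rdisk p q : s <= p -> p < q -> q <= t ->
  mobF @` rdisk p q `<=`
  rdisk (l * (p - s) / (l * (p - s) + (t - p))) (l * (q - s) / (l * (q - s) + (t - q))).
Proof.
move=> sp pq qt _ [z zpq <-].
have e1 x : l * x - l * s = l * (x - s) by ring.
have e2 x : (l - 1) * x + (t - l * s) = l * (x - s) + (t - x) by ring.
rewrite -!e2 -!e1; apply: mob_rdisk => //; apply: den_pos; lra.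
Qed.

Lemma mobF_onto z : rdisk s t z -> rdisk 0 1 (mobF z).
Proof.
move=> zst; have := @mobF_rdisk s t (lexx _) st (lexx _) (mobF z).
rewrite !subrr mulr0 mul0r addr0 divff ?mulf_neq0 ?gt_eqF ?subr_gt0 //.
by apply; exists z.
Qed.

Lemma mobG_into z : rdisk 0 1 z -> rdisk s t (mobG z).
Proof.
move=> z01.
have := @mob_rdisk _ (t - l * s) (- - (l * s)) (- (l - 1)) l 0 1 z ltr01 detG_neq0.
rewrite !mulr0 !mulr1 !add0r.
have -> : - - (l * s) / l = s by field; rewrite gt_eqF.
have -> : - (l - 1) + l = 1 by ring.
have -> : (t - l * s - - (l * s)) / 1 = t by field.
by apply.
Qed.

Lemma mobFK z : rdisk s t z -> mobG (mobF z) = z.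
Proof. by move=> h; apply: mob_inv => //; apply: den_neq0F; exact: ltW. Qed.

Lemma mobGK z : rdisk 0 1 z -> mobF (mobG z) = z.
Proof.
move=> h; have := @mob_inv _ (t - l * s) (- - (l * s)) (- (l - 1)) l z detG_neq0.
rewrite opprK (opprK (l - 1)); apply; exact: den_neq0G.
Qed.

Lemma mobF_derive z : rdisk s t z -> derivable mobF z 1 /\ 'D_1 mobF z <> 0.
Proof.
move=> h; have n0 : den (l - 1) (t - l * s) z != 0.
  by apply: den_neq0F; exact: ltW.
have [df Df] := mob_derive l (- (l * s)) n0; split=> //.
rewrite Df; apply/eqP; rewrite mulf_neq0 ?invr_eq0 ?mulf_neq0 //.
by apply/eqP => /complexI /eqP; apply/negP.
Qed.

Lemma mobG_continuous z : rdisk 0 1 z -> {for z, continuous mobG}.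
Proof.
move=> h; have n0 := den_neq0G h.
have lin (a b : R) : (fun z : plane R => a%:C%C * z + b%:C%C) @ nbhs z -->
    (a%:C%C * z + b%:C%C : plane R).
  apply: plane_cvgD; last exact: plane_cvg_cst.
  by apply: plane_cvgM; [exact: plane_cvg_cst|exact: plane_cvg_id].
rewrite /continuous_at /mobG /mob.
by apply: plane_cvgM; [exact: lin|apply: plane_cvgV => //; exact: lin].
Qed.

End MobiusBranch.

(** * The chain of disks and its wandering disks *)

Section WanderingExample.
Context {R : realType}.

(* The disk wU n has diameter [ee n / ka n, ee n * ka n] and wB n has diameter
   [ee n, ee n * mu n].  A Möbius map from wU n onto wV can send wB n into wB n.+1
   as soon as mu n * mu n.+1 - 1 <= ka n * (mu n.+1 - mu n), a comparison of
   cross-ratios, which dictates the growth of ka. *)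
Definition mu (n : nat) : R := 2 - n.+2%:R^-1.
(** The difference of [mu n.+1] and [mu n] is 1 / ((n + 2) (n + 3)), so [ka n] times it is 3; this
    exceeds the product of two values of [mu] minus 1, as these are below 2. *)
Definition ka (n : nat) : R := 3 * n.+2%:R * n.+3%:R.
(** Chosen so that [hi 0] is 1/2 and [hi n.+1] is half of [lo n], which separates the closures of
    the disks. *)
Fixpoint ee (n : nat) : R :=
  if n is m.+1 then ee m / (2 * ka m * ka m.+1) else (2 * ka 0)^-1.

Definition lo n : R := ee n / ka n.
Definition hi n : R := ee n * ka n.
(** The multiplier for which the branch sends [ee n] exactly to [ee n.+1]: solve l u = e / (1 - e)
    with u = (ee n - lo n) / (hi n - ee n) and e = [ee n.+1]. *)
Definition lam n : R :=
  ee n.+1 / (1 - ee n.+1) * (hi n - ee n) / (ee n - lo n).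

Let ka_ge n : 18 <= ka n.
Proof.
rewrite /ka; have : (2 : R) <= n.+2%:R by rewrite ler_nat.
have : (3 : R) <= n.+3%:R by rewrite ler_nat.
nra.
Qed.

Let mu_ge n : 3 / 2 <= mu n < 2.
Proof.
have n2 : (2 : R) <= n.+2%:R by rewrite ler_nat.
have h : n.+2%:R^-1 <= (2 : R)^-1 by rewrite lef_pV2 ?posrE //; lra.
have h0 : 0 < (n.+2%:R : R)^-1 by rewrite invr_gt0; lra.
by rewrite /mu; move: h h0; set k := n.+2%:R^-1 => ? ?; lra.
Qed.

Let ka_mu n : mu n * mu n.+1 - 1 <= ka n * (mu n.+1 - mu n).
Proof.
have -> : ka n * (mu n.+1 - mu n) = 3.
  rewrite /ka /mu -[n.+3%:R]natr1.
  have a0 : 0 < n.+2%:R :> R by [].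
  move: a0; set a := n.+2%:R => a0; field.
  by apply/andP; split; rewrite gt_eqF //; lra.
have := mu_ge n; have := mu_ge n.+1; nra.
Qed.

Let ee_gt0 n : 0 < ee n.
Proof.
elim: n => [|n IH] /=; first by rewrite invr_gt0; have := ka_ge 0; lra.
apply: divr_gt0 => //; have := ka_ge n; have := ka_ge n.+1; nra.
Qed.

Let hiS n : hi n.+1 = lo n / 2.
Proof.
rewrite /hi /lo /=; field.
by rewrite !gt_eqF //; have := ka_ge n; have := ka_ge n.+1; lra.
Qed.

Let lo_ee n : 0 < lo n < ee n.
Proof.
have k := ka_ge n; have e := ee_gt0 n.
rewrite /lo ltr_pdivrMr; last lra.
by rewrite divr_gt0 //=; nra.
Qed.

Let ee_mu n : ee n < ee n * mu n < hi n.
Proof.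
have k := ka_ge n; have e := ee_gt0 n; have m := mu_ge n; rewrite /hi; nra.
Qed.

Let lo_hi n : lo n < hi n.
Proof. have := lo_ee n; have := ee_mu n; lra. Qed.

Let hi_lt1 n : hi n < 1.
Proof.
elim: n => [|n IH]; last by rewrite hiS; have := lo_hi n; have := lo_ee n; lra.
rewrite /hi /=; have k := ka_ge 0.
have -> : (2 * ka 0)^-1 * ka 0 = 2^-1 by field; rewrite gt_eqF //; lra.
lra.
Qed.

Let hi_lt_lo i j : (i < j)%N -> hi j < lo i.
Proof.
elim: j => // j IH; rewrite ltnS leq_eqVlt => /predU1P[->|/IH h]; rewrite hiS.
  by have := lo_ee j; lra.
by have := lo_hi j; have := lo_ee j; lra.
Qed.

Let lam_gt0 n : 0 < lam n.
Proof.
rewrite /lam; have := lo_ee n; have := ee_mu n; have := hi_lt1 n.+1.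
have := ee_mu n.+1; have := ee_gt0 n.+1 => ? ? ? ? ?.
by rewrite !(divr_gt0, mulr_gt0) //; lra.
Qed.

Definition wU n : set (plane R) := rdisk (lo n) (hi n).
Definition wB n : set (plane R) := rdisk (ee n) (ee n * mu n).
Definition wF n : plane R -> plane R := mobF (lo n) (hi n) (lam n).

(** The left end of the diameter goes to the left end of the next one by the choice of [lam]; the
    right end does not overshoot, thanks to [ka_mu]. *)
Lemma wF_wB n : wF n @` wB n `<=` wB n.+1.
Proof.
have k := ka_ge n; have e := ee_gt0 n; have m := mu_ge n.
have e' := ee_gt0 n.+1; have m' := mu_ge n.+1; have em' := ee_mu n.+1.
have h1 := hi_lt1 n.+1; have l0 := lam_gt0 n; have em := ee_mu n; have le := lo_ee n.
have h := @mobF_rdisk _ _ _ _ (lo_hi n) l0 (ee n) (ee n * mu n).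
apply: subset_trans (h _ _ _) _; [lra..|].
have lp : lam n * (ee n - lo n) = ee n.+1 / (1 - ee n.+1) * (hi n - ee n).
  by rewrite /lam; field; rewrite !gt_eqF //; lra.
have -> : lam n * (ee n - lo n) / (lam n * (ee n - lo n) + (hi n - ee n)) = ee n.+1.
  by rewrite lp; field; apply/andP; split; rewrite gt_eqF //; lra.
set lq := lam n * (ee n * mu n - lo n); set tq := hi n - ee n * mu n.
have lp' : lam n * (ee n - lo n) * (1 - ee n.+1) = ee n.+1 * (hi n - ee n).
  by rewrite lp; field; rewrite gt_eqF //; lra.
have tq0 : 0 < tq by rewrite /tq; lra.
have lpq : lam n * (ee n - lo n) < lq by rewrite /lq ltr_pM2l //; lra.
have lp0 : 0 < lam n * (ee n - lo n) by rewrite mulr_gt0 //; lra.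
have den0 : 0 < lq + tq by lra.
apply: sub_rdisk => //.
  rewrite ltr_pdivlMr // mulrDr.
  have h2 : ee n.+1 * tq < ee n.+1 * (hi n - ee n) by rewrite ltr_pM2l // /tq; lra.
  have h3 : lam n * (ee n - lo n) * (1 - ee n.+1) < lq * (1 - ee n.+1).
    by rewrite ltr_pM2r //; lra.
  by rewrite -lp' in h2; have := lt_trans h2 h3; lra.
rewrite ler_pdivrMr //.
(* Both sides share the factor e^2 (k - 1) / k, where e = [ee n] and k = [ka n]; what remains is
   [ka_mu] rearranged. *)
have key : (hi n - ee n) * (ee n * mu n - lo n) <= mu n.+1 * (tq * (ee n - lo n)).
  have -> : (hi n - ee n) * (ee n * mu n - lo n) =
      ee n ^+ 2 * (ka n - 1) / ka n * (ka n * mu n - 1).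
    by rewrite /hi /lo; field; rewrite gt_eqF //; lra.
  have -> : mu n.+1 * (tq * (ee n - lo n)) =
      ee n ^+ 2 * (ka n - 1) / ka n * (mu n.+1 * (ka n - mu n)).
    by rewrite /tq /hi /lo; field; rewrite gt_eqF //; lra.
  rewrite ler_pM2l; first by have := ka_mu n; lra.
  by rewrite divr_gt0 ?mulr_gt0 //; lra.
have c0 : 0 < (ee n - lo n) * (1 - ee n.+1) by rewrite mulr_gt0 //; lra.
suff : lq * (1 - ee n.+1 * mu n.+1) <= ee n.+1 * mu n.+1 * tq by lra.
(* The factor [c0] allows [lam n], hidden in [lq], to be eliminated through [lp']. *)
rewrite -(ler_pM2r c0).
have -> : lq * (1 - ee n.+1 * mu n.+1) * ((ee n - lo n) * (1 - ee n.+1)) =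
    ee n.+1 * (1 - ee n.+1 * mu n.+1) * ((hi n - ee n) * (ee n * mu n - lo n)).
  transitivity (lam n * (ee n - lo n) * (1 - ee n.+1) *
    ((ee n * mu n - lo n) * (1 - ee n.+1 * mu n.+1))); first by rewrite /lq; ring.
  by rewrite lp'; ring.
have c1 : 0 < ee n.+1 * (1 - ee n.+1 * mu n.+1) by rewrite mulr_gt0 //; lra.
apply: le_trans (_ : _ <= ee n.+1 * (1 - ee n.+1 * mu n.+1) * (mu n.+1 * (tq * (ee n - lo n)))) _.
  by rewrite ler_pM2l.
have -> : ee n.+1 * (1 - ee n.+1 * mu n.+1) * (mu n.+1 * (tq * (ee n - lo n))) =
   ee n.+1 * mu n.+1 * tq * (ee n - lo n) * (1 - ee n.+1 * mu n.+1) by ring.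
rewrite (mulrA (_ * tq)) ler_pM2l; first lra.
have mu0 : 0 < mu n.+1 by lra.
have el0 : 0 < ee n - lo n by lra.
by do 3!apply: mulr_gt0 => //.
Qed.

Definition wV : set (plane R) := rdisk 0 1.
Definition wG n : plane R -> plane R := mobG (lo n) (hi n) (lam n).

Lemma wandering_branches : univalent_branches wV wU wF wG.
Proof.
split.
- by constructor; exact: 0%N.
- by apply: jordan_disk_rdisk.
- by move=> n; apply: jordan_disk_rdisk; exact: lo_hi.
- move=> i j [z []]; rewrite !closure_rdisk //.
  move=> /(crdisk_Re (lo_hi i)) /andP[h1 h2] /(crdisk_Re (lo_hi j)) /andP[h3 h4].
  by have [/hi_lt_lo h|/hi_lt_lo h|//] := ltngtP i j; exfalso; lra.
- move=> n; have := lo_ee n; have := lo_hi n; have := hi_lt1 n => ? ? ?.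
  by apply: compactly_contained_rdisk; lra.
- by move=> n z /(mobF_derive (lo_hi n) (lam_gt0 n))[].
- by move=> n z /(mobF_derive (lo_hi n) (lam_gt0 n))[].
- by move=> n z; exact: mobF_onto.
- by move=> n z; exact: mobG_into.
- by move=> n z; exact: mobFK.
- by move=> n z; exact: mobGK.
- by move=> n z; exact: mobG_continuous.
Qed.

Definition wandering_dom : set (plane R) := glue_dom wU.
Definition wandering_map : plane R -> plane R := glue wU wF.

Let UwV : wandering_dom `<=` wV.
Proof. exact: (glue_dom_sub wandering_branches). Qed.

Lemma wB_wU n : wB n `<=` wU n.
Proof.
by apply: sub_rdisk; have := lo_ee n; have := ee_mu n; lra.
Qed.

Let iter_wB k n z : wB n z -> wB (k + n) (iter k wandering_map z).
Proof.
elim: k => [|k IH] //= /IH h; apply: wF_wB; exists (iter k wandering_map z) => //.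
by rewrite /wandering_map (glueE wandering_branches (wB_wU h)).
Qed.

Let iter_wU k n z : wB n z -> wU (k + n) (iter k wandering_map z).
Proof. by move=> /(iter_wB k) /wB_wU. Qed.

Let wB_neq0 n : wB n !=set0.
Proof.
have [[_ [h _ _]] _] : jordan_disk (wB n); last exact: h.
by apply: jordan_disk_rdisk; have := ee_mu n; lra.
Qed.

(* A periodic orbit meets finitely many of the sets [wU n], and the orbit of a
   point of [wB n] leaves them all. *)
Lemma wB_wandering n : wandering_disk wandering_dom wV wandering_map (wB n).
Proof.
have [jB _] : jordan_disk (wB n).
  by apply: jordan_disk_rdisk; have := ee_mu n; lra.
have [z Bz] := wB_neq0 n.
split=> //; split.
- by case: jB.
- apply: subset_trans (_ : \bigcup_m wB m `<=` _); first by move=> w Bw; exists n.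
  apply: filled_julia_ge => //; first by move=> w [m _ Bw]; exists m => //; exact: wB_wU.
  by move=> _ [w [m _ Bw] <-]; exists m.+1 => //; exact: (iter_wB 1).
- move=> k l kl e; apply: kl.
  (* At time k the orbit of a point of [wB n] is in [wU (k + n)] and in no other component, so a
     common point of the two images forces k = l. *)
  have : (iter l wandering_map @` wB n) (iter k wandering_map z) by rewrite -e; exists z.
  move=> [w Bw wz]; apply: (@addIn n).
  apply: (ub_uniq wandering_branches (z := iter k wandering_map z)); first exact: iter_wU.
  by rewrite -wz; exact: iter_wU.
- move=> [p [[Kp [m m0 mp]] _] Bp].
  have ex i : exists j, wU j (iter i wandering_map p).
    have /(filled_julia_sub UwV) [j _ Uj] := filled_julia_iter UwV i Kp.
    by exists j.
  pose J i := projT1 (cid (ex i)).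
  have JP i : wU (J i) (iter i wandering_map p) by rewrite /J; case: (cid _).
  pose M := \max_(i < m) J i.
  have per i : iter i wandering_map p = iter (i %% m) wandering_map p.
    rewrite {1}(divn_eq i m) addnC iterD; congr (iter _ wandering_map _).
    by elim: (i %/ m)%N => //= q IH; rewrite mulSn iterD IH.
  (* The components of index at most [M] form an open set containing the periodic orbit. The orbit
     of [z] would have to stay in it from some time [N] on, yet at time N + M + 1 it has index N + M
     + 1 + n. *)
  have [_ /(_ (\bigcup_(j in [set j | (j <= M)%N]) wU j))] := Bp _ Bz.
  case.
  + by apply: bigcup_open => j _; exact: (ub_open wandering_branches).
  + move=> _ [i _ <-]; rewrite per; exists (J (i %% m)%N); last exact: JP.
    by rewrite /= /M (leq_bigmax (Ordinal (ltn_pmod i m0))).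
  + move=> N _ /(_ (N + M.+1)%N) []; first exact: leq_addr.
    move=> j /= jM Uj.
    have e := ub_uniq wandering_branches Uj (iter_wU (N + M.+1) Bz).
    by move: jM; rewrite e; lia.
Qed.

Lemma wandering_example :
  [/\ complex_box_mapping wandering_dom wV wandering_map,
    topological_disk wV,
    real_symmetric wandering_dom wV wandering_map &
    forall W, component wandering_dom W -> compactly_contained W wV /\
      exists2 B, B `<=` W & wandering_disk wandering_dom wV wandering_map B].
Proof.
split.
- exact: glue_box_mapping wandering_branches.
- by have [] := ub_cod wandering_branches.
- apply: (glue_symmetric wandering_branches (s := id)).
  + by apply: conj_invariantP => z; exact: rdisk_conjc.
  + by move=> n z; exact: rdisk_conjc.
  + by move=> n z _; exact: mob_conjc.
- move=> W /(component_glue_dom wandering_branches) [n ->]; split.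
    exact: (ub_compact wandering_branches).
  by exists (wB n); [exact: wB_wU|exact: wB_wandering].
Qed.

End WanderingExample.

(** * Planar Lebesgue measure and similarities *)

(** The push-forward is packaged with its values, in the form required by the uniqueness theorems
    below. *)
Lemma pushforward_measure d d' (T1 : measurableType d) (T2 : measurableType d')
    (R : realFieldType) (m : {measure set T1 -> \bar R}) (f : T1 -> T2) :
  measurable_fun setT f ->
  exists m' : {measure set T2 -> \bar R}, forall A, m' A = m (f @^-1` A).
Proof. by move=> mf; unshelve eexists (pushforward m f : measure _ _). Qed.

Section AffineChange.
Context {R : realType}.
Local Notation mu1 := (@lebesgue_measure R).
Local Notation mu2 := (mu1 \x mu1)%E.
Local Notation T := (measurableTypeR R).

Definition aff1 (a r : R) (x : T) : T := a + r * x.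

Definition aff2 (a b r : R) (p : T * T) : T * T := (aff1 a r p.1, aff1 b r p.2).

Lemma measurable_aff1 a r : measurable_fun setT (aff1 a r).
Proof.
apply: measurable_funD; first exact: measurable_cst.
by apply: measurable_funM; [exact: measurable_cst|exact: measurable_id].
Qed.

Lemma measurable_aff2 a b r : measurable_fun setT (aff2 a b r).
Proof.
apply: measurable_fun_pair; apply: measurableT_comp;
  by [exact: measurable_aff1|exact: measurable_fst|exact: measurable_snd].
Qed.

Lemma measurable_preimage_aff2 a b r (A : set (T * T)) : measurable A ->
  measurable (aff2 a b r @^-1` A).
Proof. by move=> mA; rewrite -[X in measurable X]setTI; exact: measurable_aff2. Qed.

(** The push-forward by [aff1 a r], multiplied by r, agrees with Lebesgue measure on the intervals
    ]u, v], hence on all measurable sets by uniqueness. *)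
Lemma lebesgue_aff1 a (r : {posnum R}) (A : set T) : measurable A ->
  mu1 A = (r%:num%:E * mu1 (aff1 a r%:num @^-1` A))%E.
Proof.
have r0 : 0 < r%:num by [].
move=> mA.
have [m mE] := pushforward_measure mu1 (measurable_aff1 a r%:num).
rewrite -mE; apply: (@lebesgue_measure_unique _ (mscale r%:num%:nng m)) => //.
move=> _ [[u v]] _ <-; 
transitivity (r%:num%:E * mu1 (aff1 a r%:num @^-1` `]u, v]%classic))%E.
  2: by rewrite -mE.
have -> : aff1 a r%:num @^-1` `]u, v]%classic =
    `](u - a) / r%:num, (v - a) / r%:num]%classic.
  apply/seteqP; split=> x; rewrite /aff1 /= !in_itv /=;
    rewrite ltr_pdivrMr // ler_pdivlMr // (mulrC x) ltrBlDl lerBrDl //.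
rewrite !lebesgue_measure_itv /= !lte_fin ltr_pM2r ?invr_gt0 // ltrD2r.
case: ifP => _; last by rewrite mule0.
by rewrite -!EFinB -EFinM; congr (_%:E); field; rewrite gt_eqF.
Qed.

(** The one-dimensional formula in each factor gives the claim for rectangles; uniqueness of the
    product measure does the rest. *)
Lemma lebesgue_aff2 a b (r : {posnum R}) (A : set (T * T)) : measurable A ->
  mu2 A = ((r%:num ^+ 2)%:E * mu2 (aff2 a b r%:num @^-1` A))%E.
Proof.
move=> mA.
have [m mE] := pushforward_measure mu2 (measurable_aff2 a b r%:num).
rewrite -mE; apply: (@product_measure_unique _ _ _ _ _ mu1 mu1
  (mscale (r%:num ^+ 2)%:nng m)) => // B C mB mC.
transitivity ((r%:num ^+ 2)%:E * mu2 (aff2 a b r%:num @^-1` (B `*` C)))%E.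
  by rewrite -mE.
have -> : aff2 a b r%:num @^-1` (B `*` C) =
    (aff1 a r%:num @^-1` B) `*` (aff1 b r%:num @^-1` C) by [].
rewrite product_measure1E; last 2 first.
- by rewrite -[X in measurable X]setTI; exact: measurable_aff1.
- by rewrite -[X in measurable X]setTI; exact: measurable_aff1.
have := lebesgue_aff1 a r mB; have := lebesgue_aff1 b r mC => /= -> ->.
by rewrite EFinM muleACA.
Qed.

Lemma negligible_aff2 a b (r : {posnum R}) (A : set (T * T)) :
  mu2.-negligible A -> mu2.-negligible (aff2 a b r%:num @^-1` A).
Proof.
move=> [B [mB B0 AB]]; exists (aff2 a b r%:num @^-1` B); split.
- exact: measurable_preimage_aff2.
- move: B0; rewrite (lebesgue_aff2 a b r mB) => /eqP; rewrite mule_eq0.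
  by rewrite eqe gt_eqF //= => /eqP.
- by move=> p /AB.
Qed.

Lemma planar_null_affine (A : set (plane R)) (c : plane R) (r : R) : 0 < r ->
  planar_null A -> planar_null [set z | A (c + r%:C%C * z)].
Proof.
case: c => a b r0 /(negligible_aff2 a b (PosNum r0)).
congr (_.-negligible _); apply/funext => -[x y]; congr A.
by apply: plane_ext; rewrite /= /aff1; ring.
Qed.

Lemma planar_measurable_affine (A : set (plane R)) (c : plane R) (r : R) :
  planar_measurable A -> planar_measurable [set z | A (c + r%:C%C * z)].
Proof.
case: c => a b /(measurable_preimage_aff2 a b r).
congr (measurable _); apply/funext => -[x y]; congr A.
by apply: plane_ext; rewrite /= /aff1; ring.
Qed.

Lemma area_affine (A : set (plane R)) (c : plane R) (r : R) : 0 < r ->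
  planar_measurable A ->
  area A = ((r ^+ 2)%:E * area [set z | A (c + r%:C%C * z)%R])%E.
Proof.
case: c => a b r0 mA; rewrite /area (lebesgue_aff2 a b (PosNum r0) mA).
congr (_ * mu2 _)%E; apply/funext => -[x y]; congr A.
by apply: plane_ext; rewrite /= /aff1; ring.
Qed.

Lemma planar_null_bigcup (I : countType) (A : I -> set (plane R)) :
  (forall i, planar_null (A i)) -> planar_null (\bigcup_i A i).
Proof.
(* Countable families are enumerated by their codes; a number that codes no index contributes the
   empty set. *)
move=> A0; pose B n : set (plane R) := if unpickle n is Some i then A i else set0.
rewrite /planar_null.
apply: (@negligibleS _ _ _ _ (\bigcup_n (plane_of @^-1` B n))).
  by move=> p [i _ Aip]; exists (pickle i) => //; rewrite /B /= pickleK.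
apply: negligible_bigcup => n; rewrite /B; case: unpickle => [i|]; first exact: A0.
by rewrite preimage_set0; exact: negligible_set0.
Qed.

Lemma planar_measurable_bigcup (I : countType) (A : I -> set (plane R)) :
  (forall i, planar_measurable (A i)) -> planar_measurable (\bigcup_i A i).
Proof.
move=> mA; rewrite /planar_measurable preimage_bigcup.
by apply: countable_bigcupT_measurable.
Qed.

Lemma planar_nullP (A : set (plane R)) : planar_measurable A ->
  planar_null A <-> area A = 0%E.
Proof. exact: negligibleP. Qed.

Lemma planar_measurable_square (c : plane R) (r : R) :
  planar_measurable (gball maxq c r).
Proof.
have -> : gball maxq c r =
    [set z | (Re z \in `]Re c - r, Re c + r[) /\ (Im z \in `]Im c - r, Im c + r[)].
  apply/seteqP; split=> z; rewrite /gball /= maxq_lt sub_Re sub_Im !ltr_distl !in_itv /=.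
    by move=> /andP[].
  by move=> [-> ->].
have mr := measurable_itv `]Re c - r, Re c + r[.
have mi := measurable_itv `]Im c - r, Im c + r[.
exact: measurableX mr mi.
Qed.

Lemma area_unit_square : area (gball maxq (0 : plane R) 1) = 4%:E.
Proof.
have -> : area (gball maxq (0 : plane R) 1) =
    mu2 (`](-1 : R), 1[%classic `*` `](-1 : R), 1[%classic).
  congr (mu2 _); apply/funext => -[x y]; apply/propext.
  rewrite /gball /= maxq_lt subr0 /= !ltr_norml !in_itv /=.
  by split=> [/andP[]|[-> ->]].
have mI := measurable_itv `](-1 : R), 1[.
have l2 : mu1 `](-1 : R), 1[%classic = 2%:E.
  have -> : lebesgue_measure `](-1 : R), 1[%classic = ((1 : R)%:E - (-1)%:E)%E.
    by rewrite lebesgue_measure_itv /= lte_fin ifT //; lra.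
  by rewrite -EFinB; congr (_%:E); ring.
set I := `](-1 : R), 1[%classic in l2 *; transitivity (mu1 I * mu1 I)%E.
  exact: product_measure1E.
by rewrite l2 -EFinM; congr (_%:E); ring.
Qed.

Lemma planar_measurable_vertical (a : R) : planar_measurable [set z | Re z = a].
Proof.
have -> : planar_measurable [set z | Re z = a] = measurable ([set a] `*` setT : set (T * T)).
  by congr measurable; apply/seteqP; split=> -[x y] /=; [move=> ->|case].
exact: measurableX.
Qed.

Lemma area_vertical (a : R) : area [set z | Re z = a] = 0%E.
Proof.
have -> : area [set z | Re z = a] = mu2 ([set a] `*` setT).
  by congr (mu2 _); apply/seteqP; split=> -[x y] /=; [move=> ->|case].
transitivity (mu1 [set a] * mu1 setT)%E; first exact: product_measure1E.
by have := lebesgue_measure_set1 a => /= ->; rewrite mul0e.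
Qed.

Lemma planar_measurable_horizontal (a : R) : planar_measurable [set z | Im z = a].
Proof.
have -> : planar_measurable [set z | Im z = a] = measurable (setT `*` [set a] : set (T * T)).
  by congr measurable; apply/seteqP; split=> -[x y] /=; [move=> ->|case].
exact: measurableX.
Qed.

Lemma area_horizontal (a : R) : area [set z | Im z = a] = 0%E.
Proof.
have -> : area [set z | Im z = a] = mu2 (setT `*` [set a]).
  by congr (mu2 _); apply/seteqP; split=> -[x y] /=; [move=> ->|case].
transitivity (mu1 setT * mu1 [set a])%E; first exact: product_measure1E.
by have := lebesgue_measure_set1 a => /= ->; rewrite mule0.
Qed.

Lemma planar_measurableU (A B : set (plane R)) :
  planar_measurable A -> planar_measurable B -> planar_measurable (A `|` B).
Proof. exact: measurableU. Qed.

Lemma planar_measurableI (A B : set (plane R)) :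
  planar_measurable A -> planar_measurable B -> planar_measurable (A `&` B).
Proof. exact: measurableI. Qed.

Lemma planar_measurableD (A B : set (plane R)) :
  planar_measurable A -> planar_measurable B -> planar_measurable (A `\` B).
Proof. exact: measurableD. Qed.

Lemma area_le (A B : set (plane R)) : planar_measurable A ->
  planar_measurable B -> A `<=` B -> (area A <= area B)%E.
Proof. by move=> mA mB AB; apply: le_measure; rewrite ?inE // => p /AB. Qed.

Lemma area_setU (A B : set (plane R)) : planar_measurable A ->
  planar_measurable B -> (area (A `|` B) <= area A + area B)%E.
Proof. by move=> mA mB; exact: measureU2. Qed.

Lemma area_bigcup_ord n (A : nat -> set (plane R)) (X : set (plane R)) :
  (forall i, planar_measurable (A i)) -> planar_measurable X ->
  X `<=` \bigcup_(i in `I_n) A i -> (area X <= \sum_(i < n) area (A i))%E.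
Proof.
move=> mA mX XA.
apply: (@content_subadditive _ _ _ mu2 (plane_of @^-1` X)
  (fun i => plane_of @^-1` A i) n) => //.
  by move=> k _; exact: mA.
rewrite -(bigcup_mkord n (fun i => plane_of @^-1` A i)) => p /XA [i ilt Ai]; by exists i.
Qed.

End AffineChange.

(** * The Sierpinski box mapping *)

Section SierpinskiExample.
Context {R : realType}.
Implicit Types (z c : plane R) (w : seq {k : 'I_9 | k != 4 :> nat}).

(* The nine cells of a 3 x 3 subdivision are numbered row by row, the central
   one being number 4. *)
Definition cell : Type := {k : 'I_9 | k != 4 :> nat}.

Definition cnum (d : cell) : nat := sval d.

(** The centre of cell k of the square is 2/3 of this vector. *)
Definition vec (k : nat) : plane R := (((k %/ 3)%N%:R - 1) +i* ((k %% 3)%N%:R - 1))%C.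

Let vec_le k : (k < 9)%N -> maxq (vec k) <= 1.
Proof.
move=> k9; rewrite maxq_le /= !ler_norml.
have h1 : (k %/ 3 <= 2)%N by lia.
have h2 : (k %% 3 <= 2)%N by lia.
move: h1 h2; rewrite -!(ler_nat R) => h1 h2.
have := ler0n R (k %/ 3); have := ler0n R (k %% 3) => ? ?; lra.
Qed.

Let natr_near (m n : nat) : `|m%:R - n%:R : R| < 1 -> m = n.
Proof.
rewrite ltr_norml => /andP[h1 h2].
have : (m%:R : R) < n.+1%:R by rewrite -natr1; lra.
have : (n%:R : R) < m.+1%:R by rewrite -natr1; lra.
rewrite !ltr_nat; lia.
Qed.

Let vec_sep k l : maxq (vec k - vec l) < 1 -> k = l.
Proof.
rewrite maxq_lt sub_Re sub_Im /=.
have e (a b : R) : a - 1 - (b - 1) = a - b by ring.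
rewrite !e => /andP[/natr_near h1 /natr_near h2].
by rewrite (divn_eq k 3) (divn_eq l 3) h1 h2.
Qed.

Let vec4 : vec 4 = 0.
Proof. by apply: plane_ext; rewrite /= subrr. Qed.

(* The similarity of ratio 3 carrying the cell number k onto the square. *)
Definition blow (k : nat) z : plane R := - (2%:C%C * vec k) + 3%:C%C * z.

Let blow_Re k z : Re (blow k z) = - (2 * ((k %/ 3)%N%:R - 1)) + 3 * Re z.
Proof. by case: z => x y; rewrite /blow /=; ring. Qed.

Let blow_Im k z : Im (blow k z) = - (2 * ((k %% 3)%N%:R - 1)) + 3 * Im z.
Proof. by case: z => x y; rewrite /blow /=; ring. Qed.

(** A word is the address of a hole, its first letter being the largest cell containing it; the
    empty word denotes the central hole, of half side 1/3. The recursion inverts the blow-up of the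
    first cell. *)
Fixpoint ctr (w : seq cell) : plane R :=
  if w is d :: w' then 3^-1%:C%C * (2%:C%C * vec (cnum d) + ctr w') else 0.

Definition rad (w : seq cell) : R := 3^-1 ^+ (size w).+1.

Definition sU (w : seq cell) : set (plane R) := gball maxq (ctr w) (rad w).
Definition sF (w : seq cell) z : plane R := (rad w)^-1%:C%C * (z - ctr w).
Definition sG (w : seq cell) z : plane R := ctr w + (rad w)%:C%C * z.
Definition sV : set (plane R) := gball maxq 0 1.

Let gm := @gauge_maxq R.

Let rad_gt0 w : 0 < rad w.
Proof. by rewrite exprn_gt0 // invr_gt0. Qed.

Let rad_le w : rad w <= 3^-1.
Proof.
rewrite /rad exprS ger_pMr ?invr_gt0 //.
by rewrite exprn_ile1 ?invr_ge0 // invf_le1 // ler1n.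
Qed.

Let radVC w : (rad w)^-1%:C%C * (rad w)%:C%C = 1 :> R[i].
Proof. by rewrite -rmorphM mulVf // gt_eqF. Qed.

(** Self-similarity: blowing up the first cell of an address removes that letter. *)
Let blow_ctr d w z : blow (cnum d) z - ctr w = 3%:C%C * (z - ctr (d :: w)).
Proof.
have h : 3%:C%C * 3^-1%:C%C = 1 :> R[i] by rewrite -rmorphM divff // pnatr_eq0.
by rewrite /blow /= mulrBr (mulrA 3%:C%C) h mul1r; ring.
Qed.

Let maxq_blow d w z :
  maxq (blow (cnum d) z - ctr w) = 3 * maxq (z - ctr (d :: w)).
Proof. by rewrite blow_ctr (gauge_scale gm). Qed.

Let rad_cons d w : 3 * rad (d :: w) = rad w.
Proof. by rewrite /rad /= [in LHS]exprS mulrA divff ?mul1r // pnatr_eq0. Qed.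

Let sU_cons d w z : sU (d :: w) z <-> sU w (blow (cnum d) z).
Proof.
by rewrite /sU /gball /= maxq_blow -(rad_cons d w) ltr_pM2l.
Qed.

Let csU_cons d w z : cgball maxq (ctr (d :: w)) (rad (d :: w)) z <->
  cgball maxq (ctr w) (rad w) (blow (cnum d) z).
Proof. by rewrite /cgball /= maxq_blow -(rad_cons d w) ler_pM2l. Qed.

Let maxqN z : maxq (- z) = maxq z.
Proof. by case: z => x y; rewrite /maxq /= !normrN. Qed.

(** By induction the blown-up point has norm below 1; 3 z differs from it by a vector of norm at
    most 2, so [z] has norm below 1. *)
Let csU_sV w z : cgball maxq (ctr w) (rad w) z -> sV z.
Proof.
elim: w z => [|d w IH] z.
  rewrite /cgball /sV /gball /= /rad expr1 !subr0 => h.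
  by apply: le_lt_trans h _; rewrite invf_lt1 // ltr1n.
move=> /csU_cons /IH; rewrite /sV /gball /= !subr0 => h.
have e : 3%:C%C * z = blow (cnum d) z + 2%:C%C * vec (cnum d) by rewrite /blow; ring.
have := gauge_add gm (blow (cnum d) z) (2%:C%C * vec (cnum d)).
rewrite -e !(gauge_scale gm) //.
have := vec_le (ltn_ord (sval d)); lra.
Qed.

(** If two blow-ups of [z] have norm below 1, their difference, which is twice a difference of
    integer vectors, has norm below 2. *)
Let blow_sep k l z : sV (blow k z) -> sV (blow l z) -> k = l.
Proof.
rewrite /sV /gball /= !subr0 => h1 h2; apply: vec_sep.
have e : 2%:C%C * (vec k - vec l) = blow l z - blow k z by rewrite /blow; ring.
have := gauge_add gm (blow l z) (- blow k z).
rewrite -e (gauge_scale gm) // maxqN; lra.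
Qed.

(** Addresses are compared letter by letter: a common point forces equal first cells, and the closed
    central hole does not meet the open outer cells, where the holes of nonempty address lie. *)
Let csU_inj w w' z : cgball maxq (ctr w) (rad w) z ->
  cgball maxq (ctr w') (rad w') z -> w = w'.
Proof.
have nil_cons v d (y : plane R) : cgball maxq (ctr [::]) (rad [::]) y ->
    cgball maxq (ctr (d :: v)) (rad (d :: v)) y -> False.
  rewrite {1}/cgball /= /rad expr1 subr0 => h1 /csU_cons /csU_sV.
  rewrite /sV /gball /= subr0 => h2.
  have : maxq (vec (cnum d) - vec 4) < 1.
    have e : 2%:C%C * (vec (cnum d) - vec 4) = - blow (cnum d) y + 3%:C%C * y.
      by rewrite vec4 /blow; ring.
    have := gauge_add gm (- blow (cnum d) y) (3%:C%C * y).
    rewrite -e !(gauge_scale gm) // maxqN; lra.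
  by move=> /vec_sep e4; have /eqP[] := svalP d.
elim: w w' z => [|d w IH] [|d' w'] z //.
- by move=> h1 h2; case: (nil_cons _ _ _ h1 h2).
- by move=> h1 h2; case: (nil_cons _ _ _ h2 h1).
- move=> /csU_cons h1 /csU_cons h2.
  have dd : d = d'.
    by apply/val_inj/val_inj; exact: blow_sep (csU_sV h1) (csU_sV h2).
  by rewrite -dd in h2 *; rewrite (IH _ _ h1 h2).
Qed.

Let sGK w z : sF w (sG w z) = z.
Proof.
by rewrite /sF /sG addrAC subrr add0r mulrA radVC mul1r.
Qed.

Let sFK w z : sG w (sF w z) = z.
Proof. by rewrite /sF /sG mulrA [X in X * _]mulrC radVC mul1r addrC subrK. Qed.

Let sF_sV w z : sU w z <-> sV (sF w z).
Proof.
rewrite /sU /sV /gball /= subr0 (gauge_scale gm) ?invr_ge0 ?ltW //.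
by rewrite mulrC ltr_pdivrMr // mul1r.
Qed.

Lemma sF_derive w z : derivable (sF w) z 1 /\ 'D_1 (sF w) z = (rad w)^-1%:C%C.
Proof.
apply: (@plane_derive _ _ (fun=> (rad w)^-1%:C%C)); first exact: plane_cvg_cst.
by apply: filterE => y; rewrite /sF; ring.
Qed.

Lemma sierpinski_branches : univalent_branches sV sU sF sG.
Proof.
split.
- by constructor; exact: [::].
- exact: jordan_disk_gball.
- by move=> w; exact: jordan_disk_gball.
- by move=> w w' [z []]; rewrite !(closure_gball gm) //; exact: csU_inj.
- move=> w; split; rewrite (closure_gball gm) //; first exact: compact_cgball.
  by move=> z; exact: csU_sV.
- by move=> w z _; have [] := sF_derive w z.
- move=> w z _; have [_ ->] := sF_derive w z.
  by apply/eqP/negP => /eqP e; have /eqP := radVC w; rewrite e mul0r eq_sym oner_eq0.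
- by move=> w z /sF_sV.
- by move=> w z Vz; apply/sF_sV; rewrite sGK.
- by move=> w z _; exact: sFK.
- by move=> w z _; exact: sGK.
- move=> w z _; rewrite /continuous_at /sG.
  apply: plane_cvgD; first exact: plane_cvg_cst.
  by apply: plane_cvgM; [exact: plane_cvg_cst|exact: plane_cvg_id].
Qed.

Let sb := sierpinski_branches.
Definition sierpinski_dom : set (plane R) := glue_dom sU.
Definition sierpinski_map : plane R -> plane R := glue sU sF.
Definition sierpinski_julia : set (plane R) := filled_julia sierpinski_dom sV sierpinski_map.
Let UsV : sierpinski_dom `<=` sV := glue_dom_sub sb.

(** * The carpet has area zero *)

Let measurable_Us : planar_measurable sierpinski_dom.
Proof. by apply: planar_measurable_bigcup => w; exact: planar_measurable_square. Qed.

Let measurable_sV : planar_measurable sV.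
Proof. exact: planar_measurable_square. Qed.

Let measurable_blow k (A : set (plane R)) : planar_measurable A ->
  planar_measurable [set z | A (blow k z)].
Proof. exact: planar_measurable_affine. Qed.

(** Off the two grid values, a coordinate lies in one of three open thirds, numbered so that the
    rescaled value is a coordinate of [blow]. *)
Let third (x : R) : `|x| < 1 -> x = 3^-1 \/ x = - 3^-1 \/
  exists2 n, (n < 3)%N & `|- (2 * (n%:R - 1)) + 3 * x| < 1.
Proof.
rewrite ltr_norml => /andP[x0 x1].
have [->|h1] := eqVneq x 3^-1; first by left.
have [->|h2] := eqVneq x (- 3^-1); first by right; left.
right; right; have [h3|h3] := ltP x (- 3^-1).
  by exists 0%N => //; rewrite ltr_norml; lra.
have {h2}h3 : - 3^-1 < x by rewrite lt_neqAle eq_sym h2.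
have [h4|h4] := ltP x 3^-1.
  by exists 1%N => //; rewrite ltr_norml; lra.
have {h1}h4 : 3^-1 < x by rewrite lt_neqAle eq_sym h1.
by exists 2%N => //; rewrite ltr_norml; lra.
Qed.

Let grid : set (plane R) :=
  [set z | Re z = 3^-1] `|` [set z | Re z = - 3^-1] `|`
  ([set z | Im z = 3^-1] `|` [set z | Im z = - 3^-1]).

Let measurable_grid : planar_measurable grid.
Proof.
by apply: planar_measurableU; apply: planar_measurableU;
  [exact: planar_measurable_vertical|exact: planar_measurable_vertical
  |exact: planar_measurable_horizontal|exact: planar_measurable_horizontal].
Qed.

Let area_grid : area grid = 0%E.
Proof.
apply/(planar_nullP measurable_grid); apply: negligibleU; apply: negligibleU.
- apply/(planar_nullP (planar_measurable_vertical _)); exact: area_vertical.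
- apply/(planar_nullP (planar_measurable_vertical _)); exact: area_vertical.
- apply/(planar_nullP (planar_measurable_horizontal _)); exact: area_horizontal.
- apply/(planar_nullP (planar_measurable_horizontal _)); exact: area_horizontal.
Qed.

Definition carpet : set (plane R) := sV `\` sierpinski_dom.

Let measurable_carpet : planar_measurable carpet.
Proof. exact: planar_measurableD. Qed.

(** The central open cell is a hole, so its index is given to the grid lines instead. *)
Let cover (k : nat) : set (plane R) :=
  if k == 4 then grid else [set z | carpet (blow k z)].

(** A point off the grid lies in an open cell. In the central one it would be in the domain; in
    another one, its blow-up avoids all holes since holes pull back to holes. *)
Let carpet_cover : carpet `<=` \bigcup_(k in `I_9) cover k.
Proof.
move=> z [Vz Uz]; have := Vz; rewrite /sV /gball /= subr0 maxq_lt => /andP[].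
have on_grid : grid z -> (\bigcup_(k in `I_9) cover k) z by exists 4%N.
move=> /third [h|[h|[a a3 ha]]] /third [h'|[h'|[b b3 hb]]];
  try by apply: on_grid; rewrite /grid /=; tauto.
pose k := (3 * a + b)%N.
have k9 : (k < 9)%N by rewrite /k; lia.
have ka : (k %/ 3)%N = a by rewrite /k; lia.
have kb : (k %% 3)%N = b by rewrite /k; lia.
have Vk : sV (blow k z).
  by rewrite /sV /gball /= subr0 maxq_lt blow_Re blow_Im ka kb ha hb.
exists k => //; rewrite /cover; case: eqP => [k4|/eqP k4].
  exfalso; apply: Uz; exists [::] => //.
  move: Vk; rewrite k4 /blow vec4 mulr0 oppr0 add0r.
  rewrite /sV /sU /gball /= !subr0 (gauge_scale gm) // /rad expr1 => h.
  by rewrite -(ltr_pM2l (ltr0n _ 3)) divff // pnatr_eq0.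
split=> // -[w _ wandering_dom]; apply: Uz.
pose d : cell := exist _ (Ordinal k9) k4.
by exists (d :: w) => //; apply/sU_cons.
Qed.

Lemma carpet_null : planar_null carpet.
Proof.
apply/(planar_nullP measurable_carpet).
have le4 : (area carpet <= 4%:E)%E.
  by rewrite -area_unit_square; apply: area_le => // z [].
have ge0 : (0 <= area carpet)%E by exact: measure_ge0.
(* Finiteness is essential: m <= 8 m / 9 gives m = 0 only for finite m. *)
have fin : area carpet \is a fin_num.
  by rewrite ge0_fin_numE //; apply: le_lt_trans le4 _; rewrite ltry.
pose x := fine (area carpet).
have xE : area carpet = x%:E by rewrite fineK.
have x0 : 0 <= x by rewrite -lee_fin -xE.
have coverE k : area (cover k) = (if k == 4%N then 0 else x / 9)%:E.
  rewrite /cover; case: eqP => // _.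
  have := area_affine (- (2%:C%C * vec k)) (ltr0n _ 3 : 0 < 3) measurable_carpet.
  rewrite -/(blow k) xE; set a := area _.
  (* In the extended reals x = 9 a with x finite, which excludes the infinite values of a. *)
  case: a => [a| |].
  - by rewrite -EFinM => -[->]; congr (_%:E); field.
  - by rewrite gt0_muley // lte_fin exprn_gt0.
  - by rewrite gt0_muleNy // lte_fin exprn_gt0.
have : (area carpet <= \sum_(k < 9) area (cover k))%E.
  apply: area_bigcup_ord => // k; rewrite /cover; case: eqP => // _.
  exact: measurable_blow.
rewrite (eq_bigr _ (fun (k : 'I_9) _ => coverE k)) sumEFin xE lee_fin.
rewrite !big_ord_recl big_ord0 /= => h; congr (_%:E); lra.
Qed.

(** * Full measure and empty interior of the filled Julia set *)

Let Ks_sub : sierpinski_julia `<=` sierpinski_dom.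
Proof. exact: filled_julia_sub. Qed.

Let Ks_fix z : sierpinski_julia z <-> sierpinski_dom z /\ sierpinski_julia (sierpinski_map z).
Proof. exact: filled_juliaE. Qed.

Let FsE w z : sU w z -> sierpinski_map z = sF w z.
Proof. exact: (glueE sb). Qed.

Let preimage_bigcupE (A : set (plane R)) :
  preimage_in sierpinski_dom sierpinski_map A = \bigcup_w (sU w `&` [set z | A (sF w z)]).
Proof.
apply/seteqP; split=> [z [[w _ wandering_dom]] /=|z [w _ [wandering_dom /= Aw]]].
  by rewrite (FsE wandering_dom) => Aw; exists w.
by split; [exists w|rewrite /= (FsE wandering_dom)].
Qed.

Let sF_affine w z : sF w z = - ((rad w)^-1%:C%C * ctr w) + (rad w)^-1%:C%C * z.
Proof. by rewrite /sF mulrBr addrC. Qed.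

Let measurable_preimage (A : set (plane R)) : planar_measurable A ->
  planar_measurable (preimage_in sierpinski_dom sierpinski_map A).
Proof.
move=> mA; rewrite preimage_bigcupE; apply: planar_measurable_bigcup => w.
apply: planar_measurableI; first exact: planar_measurable_square.
have := planar_measurable_affine (- ((rad w)^-1%:C%C * ctr w)) (rad w)^-1 mA.
by under eq_set do rewrite -sF_affine.
Qed.

Let null_preimage (A : set (plane R)) : planar_null A ->
  planar_null (preimage_in sierpinski_dom sierpinski_map A).
Proof.
move=> nA; rewrite preimage_bigcupE; apply: planar_null_bigcup => w.
apply: (@negligibleS _ _ _ _ (plane_of @^-1` [set z | A (sF w z)])).
  by move=> p [].
have r0 : 0 < (rad w)^-1 by rewrite invr_gt0.
have := planar_null_affine (- ((rad w)^-1%:C%C * ctr w)) r0 nA.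
by under eq_set do rewrite -sF_affine.
Qed.

Let measurable_Ks : planar_measurable sierpinski_julia.
Proof.
rewrite /sierpinski_julia /filled_julia /planar_measurable preimage_bigcap.
apply: bigcapT_measurable => n; elim: n => [|n IH] //=.
exact: measurable_preimage.
Qed.

(** A point that fails the condition of level n + 1 is in the carpet or is mapped to a point failing
    level n. Preimages of null sets are null, being countable unions of subsets of similar
    copies. *)
Let null_sV_Ks : planar_null (sV `\` sierpinski_julia).
Proof.
have step n : planar_null (sV `\` iter n (preimage_in sierpinski_dom sierpinski_map) sV).
  elim: n => [|n IH] /=; first by rewrite setDv; exact: negligible_set0.
  apply: (@negligibleS _ _ _ _ (plane_of @^-1`
    (carpet `|` preimage_in sierpinski_dom sierpinski_map
      (sV `\` iter n (preimage_in sierpinski_dom sierpinski_map) sV)))).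
    move=> p [Vp]; have [Up h|] := pselect (sierpinski_dom (plane_of p)); last by left.
    right; split=> //; split; last by move=> Ap; apply: h.
    by case: Up => w _ wandering_dom; rewrite (FsE wandering_dom); apply/sF_sV.
  by apply: negligibleU; [exact: carpet_null|exact: null_preimage].
apply: (@negligibleS _ _ _ _ (plane_of @^-1`
  (\bigcup_n (sV `\` iter n (preimage_in sierpinski_dom sierpinski_map) sV)))).
  move=> p [Vp nK]; apply: contrapT => h; apply: nK => n _.
  by apply: contrapT => nA; apply: h; exists n.
exact: planar_null_bigcup.
Qed.

Let area_Ks : (0 < area sierpinski_julia)%E.
Proof.
have mD : planar_measurable (sV `\` sierpinski_julia) by exact: planar_measurableD.
have : (area sV <= area sierpinski_julia + area (sV `\` sierpinski_julia))%E.
  apply: (@le_trans _ _ (area (sierpinski_julia `|` (sV `\` sierpinski_julia)))).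
    apply: area_le => //; first exact: planar_measurableU.
    by move=> z Vz; have [Kz|Kz] := pselect (sierpinski_julia z); [left|right].
  exact: area_setU.
rewrite ((planar_nullP mD).1 null_sV_Ks) adde0 area_unit_square.
by apply: lt_le_trans; rewrite lte_fin.
Qed.

(* A point of the square on the boundary of the central hole. *)
Let ledge : plane R := (3^-1 +i* 0)%C.

Let ledge_sV : sV ledge.
Proof. by rewrite /sV /gball /= subr0 maxq_lt /= normr0 ltr01 andbT ger0_norm; lra. Qed.

Let ledge_Us : ~ sierpinski_dom ledge.
Proof.
have m : maxq ledge = 3^-1 by rewrite /maxq /= normr0 ger0_norm ?max_l //; lra.
move=> [w _ wandering_dom]; have e : [::] = w.
  apply: (@csU_inj _ _ ledge); last exact: gball_sub.
  by rewrite /cgball /= subr0 m /rad expr1.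
by move: wandering_dom; rewrite -e /sU /gball /= subr0 m /rad expr1 ltxx.
Qed.

(** The point [ledge], or any point outside the filled Julia set, is pulled back along the orbit of
    [z]; every inverse branch contracts by at least 3, and the initial distance in the square is at
    most 2. *)
Let not_Ks_near n z : sierpinski_julia z ->
  exists z', [/\ sV z', ~ sierpinski_julia z' & maxq (z' - z) <= 2 / 3 ^+ n].
Proof.
elim: n z => [|n IH] z Kz.
  exists ledge; split=> //; first by move=> /Ks_sub.
  have := UsV (Ks_sub Kz); have := ledge_sV; rewrite /sV /gball /= !subr0 => h1 h2.
  have := gauge_add gm ledge (- z); rewrite maxqN expr0 divr1; lra.
have [[w _ wandering_dom] KF] := (Ks_fix z).1 Kz.
have [z'' [Vz nK hz]] := IH _ KF.
have UG : sU w (sG w z'') by apply/sF_sV; rewrite sGK.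
exists (sG w z''); split.
- by apply: UsV; exists w.
- by move=> /Ks_fix [_]; rewrite (FsE UG) sGK.
- rewrite -[X in _ - X](sFK w) -(FsE wandering_dom).
  have -> : sG w z'' - sG w (sierpinski_map z) = (rad w)%:C%C * (z'' - sierpinski_map z).
    by rewrite /sG; ring.
  rewrite (gauge_scale gm) ?(ltW (rad_gt0 w)) //.
  apply: (@le_trans _ _ (3^-1 * (2 / 3 ^+ n))).
    by apply: ler_pM => //; [exact: ltW|exact: (gauge_ge0 gm)].
  by rewrite exprS invfM mulrCA.
Qed.

Let nbhs_gball (A : set (plane R)) z : nbhs z A ->
  exists2 e : R, 0 < e & gball maxq z e `<=` A.
Proof.
move=> /nbhs_ballP [e /= /gt0_realE [e0 ->] eA].
exists (Re e / 2); first by rewrite divr_gt0.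
move=> y; rewrite /gball /= maxq_lt => /andP[h1 h2]; apply: eA.
by rewrite -ball_normE /= distrC; exact: norm_lt_coords.
Qed.

Let interior_Ks : interior sierpinski_julia = set0.
Proof.
rewrite -subset0 => z /nbhs_gball [e e0 eK].
have Kz : sierpinski_julia z by apply: eK; rewrite /gball /= subrr (gauge0 gm).
(* Here 2 / e < n <= 3^n. *)
pose n := Num.bound (2 / e).
have n3 : 2 / 3 ^+ n < e.
  rewrite ltr_pdivrMr ?exprn_gt0 // mulrC -ltr_pdivrMr //.
  apply: (lt_le_trans (archi_boundP _)); first by rewrite divr_ge0 // ltW.
  by rewrite -natrX ler_nat ltnW // ltn_expl.
have [z' [_ nK hz]] := not_Ks_near n Kz.
by apply: nK; apply: eK; rewrite /gball /=; exact: le_lt_trans hz n3.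
Qed.

(** With empty interior, the filled Julia set lies in its own boundary, so one line field serves for
    both sets. *)
Let julia_filled_Ks : julia_filled sierpinski_dom sV sierpinski_map = sierpinski_julia.
Proof.
apply/seteqP; split=> [z []//|z Kz]; split=> //; split.
  exact: subset_closure.
by rewrite -/sierpinski_julia interior_Ks.
Qed.

(* The derivative is a positive real number, so the horizontal line field is
   invariant. *)
Let line_field_Ks :
  carries_invariant_line_field sierpinski_dom sierpinski_map sierpinski_julia.
Proof.
exists sierpinski_julia, (fun=> 0%E); split; first by split.
split=> //.
- exact: measurable_cst.
- by apply/seteqP; split=> z /Ks_fix.
- move=> z /Ks_sub [w _ wandering_dom].
  rewrite (derive_glue sb wandering_dom) (sF_derive w z).2 /=.
  apply/seteqP; split=> [_ [y /= + <-]|y /= hy].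
    by rewrite !mul0r scale_Im => ->; rewrite mulr0.
  exists ((rad w)%:C%C * y); first by rewrite /= scale_Im scale_Re hy mul0r mulr0 mul0r.
  by rewrite mulrA radVC mul1r.
Qed.

(** * Symmetry under complex conjugation *)

Lemma flip_subproof (k : 'I_9) : (3 * (k %/ 3) + (2 - k %% 3) < 9)%N.
Proof. by have := ltn_ord k; lia. Qed.

(** Conjugation acts on cells by keeping the quotient by 3, which gives the real part, and
    reflecting the remainder. *)
Definition flip_ord (k : 'I_9) : 'I_9 := Ordinal (flip_subproof k).

Lemma flip_cell_subproof (d : cell) : flip_ord (sval d) != 4 :> nat.
Proof. by have := ltn_ord (sval d); have := svalP d; rewrite /=; lia. Qed.

Definition flip (d : cell) : cell := exist _ (flip_ord (sval d)) (flip_cell_subproof d).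

Let vec_flip d : vec (cnum (flip d)) = conjc (vec (cnum d)).
Proof.
rewrite /vec /cnum /flip /=; set k : nat := sval d.
have -> : ((3 * (k %/ 3) + (2 - k %% 3)) %/ 3 = k %/ 3)%N by lia.
have -> : ((3 * (k %/ 3) + (2 - k %% 3)) %% 3 = 2 - k %% 3)%N by lia.
by apply: plane_ext => //=; rewrite natrB; [lra|lia].
Qed.

Let ctr_flip w : ctr (map flip w) = conjc (ctr w).
Proof.
elim: w => [|d w IH] /=; first by rewrite oppr0.
rewrite IH vec_flip; case: (ctr w) (vec _) => [a b] [a' b'].
by apply: plane_ext => /=; ring.
Qed.

Let rad_flip w : rad (map flip w) = rad w.
Proof. by rewrite /rad size_map. Qed.

Let maxq_conjc z : maxq (conjc z) = maxq z.
Proof. by case: z => x y; rewrite /maxq /= normrN. Qed.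

Lemma sierpinski_example :
  [/\ complex_box_mapping sierpinski_dom sV sierpinski_map,
    real_symmetric sierpinski_dom sV sierpinski_map,
    planar_null (sierpinski_dom `\` filled_julia sierpinski_dom sV sierpinski_map) /\
    interior (filled_julia sierpinski_dom sV sierpinski_map) = set0,
    [/\ planar_measurable (filled_julia sierpinski_dom sV sierpinski_map),
      (0 < area (filled_julia sierpinski_dom sV sierpinski_map))%E &
      critical sierpinski_dom sierpinski_map = set0] &
    carries_invariant_line_field sierpinski_dom sierpinski_map
      (julia_filled sierpinski_dom sV sierpinski_map) /\
    carries_invariant_line_field sierpinski_dom sierpinski_map
      (filled_julia sierpinski_dom sV sierpinski_map)].
Proof.
split.
- exact: glue_box_mapping sb.
- apply: (glue_symmetric sb (s := map flip)).
  + by apply: conj_invariantP => z; rewrite /sV /gball /= !subr0 maxq_conjc.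
  + by move=> w z; rewrite /sU /gball /= ctr_flip rad_flip -rmorphB maxq_conjc.
  + move=> w z _; rewrite /sF ctr_flip rad_flip -rmorphB.
    by case: (z - ctr w) => x y; apply: plane_ext => /=; ring.
- split; last exact: interior_Ks.
  apply: negligibleS null_sV_Ks => p [Up nK]; split=> //; exact: UsV.
- by split; [exact: measurable_Ks|exact: area_Ks|exact: critical_glue sb].
- by rewrite julia_filled_Ks; split; exact: line_field_Ks.
Qed.

End SierpinskiExample.

(** * The three examples *)

Section IdentityExample.
Context {R : realType}.

(** Every orbit is constant, so the filled Julia set is [V], which is open and hence disjoint from
    its boundary. *)
Lemma identity_example (V : set (plane R)) : jordan_disk V -> conj_invariant V ->
  [/\ complex_box_mapping V V id, filled_julia V V id = V,
    julia_dom V V id = set0 & real_symmetric V V id].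
Proof.
move=> jV sV; have [[oV [V0 _ _]] _] := jV.
have cV := jordan_disk_connected jV.
have KV : filled_julia V V id = V.
  apply/seteqP; split; first exact: filled_julia_sub.
  by apply: filled_julia_ge => // _ [z Vz <-].
have Did (z : plane R) : derivable id z 1 /\ 'D_1 id z = 1 :> plane R.
  apply: (@plane_derive _ id (fun=> 1)); first exact: plane_cvg_cst.
  by apply: filterE => y; rewrite mulr1.
split=> //; last first.
  rewrite /julia_dom KV /bd -subset0 => z [[_ +] Vz].
  by rewrite ((interior_id _).1 oV).
split=> //.
- by move=> _ [z Vz <-].
- have -> : critical V id = set0; last exact: finite_set0.
  rewrite -subset0 => z [_]; have [_ ->] := Did z.
  by apply/eqP; exact: oner_neq0.
- exists [set V]; split; [exact: finite_set1| |by rewrite bigcup_set1].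
  by split=> [A ->|A B /= -> ->].
- by move=> W /(component_connected_set cV) ->; left; exact: connected_component_set.
- move=> W /(component_connected_set cV) ->; split.
    by rewrite image_id; exact: connected_component_set.
  by move=> K cK; rewrite image_id => /setIidr ->.
Qed.

End IdentityExample.

Theorem theorem3p1 (R : realType) :
  exists (U1 V1 U2 V2 U3 V3 : set (plane R))
         (F1 F2 F3 : plane R -> plane R),
    [/\ complex_box_mapping U1 V1 F1,
        complex_box_mapping U2 V2 F2 &
        complex_box_mapping U3 V3 F3] /\
    [/\ (* (1) *)
        filled_julia U1 V1 F1 = V1 /\ julia_dom U1 V1 F1 = set0,
        (* (2) *)
        [/\ planar_null (U2 `\` filled_julia U2 V2 F2),
            interior (filled_julia U2 V2 F2) = set0,
            exists A : set (plane R),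
              [/\ A `<=` filled_julia U2 V2 F2,
                  planar_measurable A,
                  (0 < area A)%E,
                  planar_null (filled_julia U2 V2 F2 `\` A) &
                  forall z c, A z -> critical U2 F2 c ->
                    ~ orbit_clusters_at F2 z c],
            carries_invariant_line_field U2 F2 (julia_filled U2 V2 F2) &
            carries_invariant_line_field U2 F2 (filled_julia U2 V2 F2)] &
        (* (3) *)
        topological_disk V3 /\
        forall W, component U3 W ->
          compactly_contained W V3 /\
          exists2 B, B `<=` W & wandering_disk U3 V3 F3 B] /\
    (* symmetry with respect to the real line *)
    [/\ real_symmetric U1 V1 F1,
        real_symmetric U2 V2 F2 &
        real_symmetric U3 V3 F3].
Proof.
have gm := @gauge_maxq R.
have conj_sV : conj_invariant (@sV R).
  by apply: conj_invariantP => -[x y]; rewrite /sV /gball /= !subr0 /maxq /= normrN.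
have [b1 K1 J1 s1] := identity_example (jordan_disk_gball gm 0 ltr01) conj_sV.
have [b2 s2 [n2 i2] [m2 a2 c2] [lj2 lK2]] := @sierpinski_example R.
have [b3 d3 s3 w3] := @wandering_example R.
exists sV, sV, sierpinski_dom, sV, wandering_dom, wV, id, sierpinski_map, wandering_map.
split=> //; split=> //; split=> //; split=> //.
(* All of the filled Julia set can be taken: there are no critical points for an orbit to accumulate
   on. *)
exists (filled_julia sierpinski_dom sV sierpinski_map); split=> //.
  by rewrite setDv; exact: negligible_set0.
by move=> z c _; rewrite c2.
Qed.
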